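(* Let $p\ge11$ be prime, $\widetilde H$ a (normalized) primitive projective-augmented module of type $\bar\rho$, with $\bar\rho$ très ramifiée, and $\varepsilon=\omega^{-s_\varepsilon}\times\omega^{s_\varepsilon}$ with $0\le s_\varepsilon\le p-2$. For every integer $k\ge2$, $$d_k^{\mathrm{Iw}}\bigl(\varepsilon(1\times\omega^{2-k})\bigr)=\left\lfloor\frac{k-2-s_\varepsilon}{p-1}\right\rfloor+1.$$ For $k=k_\varepsilon+(p-1)k_\bullet$ with $k_\bullet\in\mathbb Z_{\ge0}$, this becomes $$d_k^{\mathrm{Iw}}=k_\bullet+1-\delta_\varepsilon.$$ In particular $d_k^{\mathrm{Iw}}$ increases by one when $k$ is replaced by $k+p-1$, and it can be odd.
   Context: $G=\mathrm{GL}_2(\mathbb Q_p)$, $K=\mathrm{GL}_2(\mathbb Z_p)$, $\mathrm{Iw}\subset K$ is the subgroup of matrices upper triangular mod $p$, $I_1$ its pro-$p$ Sylow subgroup, $\Delta^2\subset K$ the diagonal torsion subgroup (identified with $(\mathbb F_p^\times)^2$), $\Pi=\left(\begin{smallmatrix}0&1\\ p&0\end{smallmatrix}\right)$. $E/\mathbb Q_p$ is a sufficiently large finite extension with ring of integers $\mathcal O$, uniformizer $\varpi$, residue field $\mathbb F$. $\omega$ is the mod $p$ cyclotomic character and also the Teichmüller character $\mathbb F_p^\times\to\mathcal O^\times$. $\bar\rho\cong\left(\begin{smallmatrix}\omega&*\\ 0&1\end{smallmatrix}\right)$ is nonsplit with extension class $c\in H^1(G_{\mathbb Q_p},\mathbb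 F(\omega))$ très ramifiée, i.e. $\langle c,\mathrm{ord}_p\rangle\neq0$ under the local Tate pairing with $H^1(G_{\mathbb Q_p},\mathbb F)\cong\mathrm{Hom}_{\rm cont}(\mathbb Q_p^\times,\mathbb F)$, $\mathrm{ord}_p$ being the unramified class with $\mathrm{ord}_p(p)=1$. A primitive projective-augmented module of type $\bar\rho$ is a finite projective right $\mathcal O[\![K]\!]$-module $\widetilde H$ with a continuous right $G$-action extending its $K$-action such that: (1) its quotient by $\varpi$ and all $g-1$, $g\in1+pM_2(\mathbb Z_p)$, is one copy of the projective envelope of $\sigma_{p-1,0}=\mathrm{Sym}^{p-1}\mathbb F^2$ over $\mathbb F[\mathrm{GL}_2(\mathbb F_p)]$; (2) $p\,\mathrm{id}$ acts by a scalar in $\mathcal O^\times$; (3) $\widetilde H\cong\widetilde H_0\widehat\otimes_{\mathcal O}\mathcal O[\![1+p\mathbb Z_p]\!]$ as $G$-modules, where scalars in $1+p\mathbb Z_p$ act trivially on $\widetilde H_0$ and $G$ acts on the second factor through the projection of $\det g\in\mathbb Q_p^\times=p^{\mathbb Z}\times\mu_{p-1}\times(1+p\mathbb Z_p)$ to $1+p\mathbb Z_p$. Normalization (by finite coefficient extension and unramified twist): $p\,\mathrm{id}$ acts trivially and $\widetilde H$ has an $\mathcal O[\![I_1]\!]$-basis $e$, fixed by $\Delta^2$, with $e\Pi=-e$. For a character $\psi$ of $\Delta^2$, $\mathcal O[z]^{\le k-2}\otimes\psi$ is the space of polynomials of degree $\le k-2$ with right action of $g=\left(\begin{smallmatrix}\alpha&\beta\\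 \gamma&\delta\end{smallmatrix}\right)\in\mathrm{Iw}$ given by $h|_g(z)=\psi(\overline{\det g}/\bar\delta,\bar\delta)(\gamma z+\delta)^{k-2}h\bigl(\frac{\alpha z+\beta}{\gamma z+\delta}\bigr)$ (bars: reduction mod $p$), and $$d_k^{\mathrm{Iw}}(\psi)=\mathrm{rank}_{\mathcal O}\,\mathrm{Hom}_{\mathcal O[\![\mathrm{Iw}]\!]}\bigl(\widetilde H,\mathcal O[z]^{\le k-2}\otimes\psi\bigr).$$ When $\psi=\varepsilon(1\times\omega^{2-k})$ is fixed it is omitted from the notation. $\{x\}\in\{0,\dots,p-2\}$ is the residue of $x$ mod $p-1$; $k_\varepsilon=2+\{2s_\varepsilon\}$ and $\delta_\varepsilon=\lfloor 2s_\varepsilon/(p-1)\rfloor$. *)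

(* Defs.v *)
From HB Require Import structures.
From mathcomp Require Import all_boot all_order all_fingroup all_algebra all_field.
From mathcomp Require Import boolp classical_sets functions.

Set Implicit Arguments.
Unset Strict Implicit.
Unset Printing Implicit Defensive.

Import GRing.Theory.
Local Open Scope ring_scope.

(* Z_p is the inverse limit of the rings Z/p^n; the n-th component is stored   *)
(* as its representative in [0, p^n[.                                          *)
Record padic_int (p : nat) (pp : prime p) := PadicInt {
  padic_res : nat -> int;
  padic_resP : forall n, padic_res n = (padic_res n.+1 %% p%:Z ^+ n)%Z }.

HB.instance Definition _ p pp := gen_eqMixin (@padic_int p pp).
HB.instance Definition _ p pp := gen_choiceMixin (@padic_int p pp).

Section PadicInt.
Variables (p : nat) (pp : prime p).
Local Notation Zp := (padic_int pp).
Implicit Types x y z : Zp.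

Lemma padic_inj x y : (forall n, padic_res x n = padic_res y n) -> x = y.
Proof.
case: x y => [f fP] [g gP] /= /funext fg; subst g.
by congr PadicInt; apply: Prop_irrelevance.
Qed.

Lemma padic_mod x n : (padic_res x n %% p%:Z ^+ n)%Z = padic_res x n.
Proof. by rewrite padic_resP modz_mod. Qed.

(* Any sequence of integers that is compatible modulo the p^n gives an element *)
(* of Z_p.                                                                     *)
Lemma padic_of_subproof (f : nat -> int) :
  (forall n, (f n = f n.+1 %[mod p%:Z ^+ n])%Z) ->
  forall n, (f n %% p%:Z ^+ n)%Z =
            ((f n.+1 %% p%:Z ^+ n.+1)%Z %% p%:Z ^+ n)%Z.
Proof.
move=> fP n; rewrite fP; apply/eqP; rewrite eqz_mod_dvd.
rewrite {1}(divz_eq (f n.+1) (p%:Z ^+ n.+1)) addrK.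
by rewrite exprS mulrA dvdz_mull.
Qed.

Definition padic_of f fP : Zp := PadicInt pp (@padic_of_subproof f fP).

Lemma padic_compat x n : (padic_res x n = padic_res x n.+1 %[mod p%:Z ^+ n])%Z.
Proof. by rewrite -padic_resP padic_mod. Qed.

Lemma padic_add_subproof x y n :
  (padic_res x n + padic_res y n =
     padic_res x n.+1 + padic_res y n.+1 %[mod p%:Z ^+ n])%Z.
Proof. by rewrite -modzDm padic_compat (padic_compat y) modzDm. Qed.

Lemma padic_opp_subproof x n :
  (- padic_res x n = - padic_res x n.+1 %[mod p%:Z ^+ n])%Z.
Proof. by rewrite -modzNm padic_compat modzNm. Qed.

Lemma padic_mul_subproof x y n :
  (padic_res x n * padic_res y n =
     padic_res x n.+1 * padic_res y n.+1 %[mod p%:Z ^+ n])%Z.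
Proof. by rewrite -modzMm padic_compat (padic_compat y) modzMm. Qed.

Definition padic_zero : Zp := @padic_of (fun=> 0) (fun=> erefl).
Definition padic_one : Zp := @padic_of (fun=> 1) (fun=> erefl).
Definition padic_add x y : Zp := padic_of (padic_add_subproof x y).
Definition padic_opp x : Zp := padic_of (padic_opp_subproof x).
Definition padic_mul x y : Zp := padic_of (padic_mul_subproof x y).

Fact padic_addA : associative padic_add.
Proof.
by move=> x y z; apply: padic_inj => n /=; rewrite modzDml modzDmr addrA.
Qed.
Fact padic_addC : commutative padic_add.
Proof. by move=> x y; apply: padic_inj => n /=; rewrite addrC. Qed.
Fact padic_add0 : left_id padic_zero padic_add.
Proof. by move=> x; apply: padic_inj => n /=; rewrite mod0z add0r padic_mod. Qed.
Fact padic_addN : left_inverse padic_zero padic_opp padic_add.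
Proof. by move=> x; apply: padic_inj => n /=; rewrite modzDml addNr. Qed.
Fact padic_mulA : associative padic_mul.
Proof.
by move=> x y z; apply: padic_inj => n /=; rewrite modzMml modzMmr mulrA.
Qed.
Fact padic_mulC : commutative padic_mul.
Proof. by move=> x y; apply: padic_inj => n /=; rewrite mulrC. Qed.
Fact padic_mul1 : left_id padic_one padic_mul.
Proof.
by move=> x; apply: padic_inj => n /=; rewrite modzMml mul1r padic_mod.
Qed.
Fact padic_mulDl : left_distributive padic_mul padic_add.
Proof.
move=> x y z; apply: padic_inj => n /=.
by rewrite modzMml modzDml modzDmr mulrDl.
Qed.
Fact padic_1neq0 : padic_one != padic_zero.
Proof.
apply/eqP => /(congr1 (fun x => padic_res x 1)) /=; rewrite expr1 mod0z.
by rewrite modz_small //= ltz_nat prime_gt1.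
Qed.

HB.instance Definition _ :=
  GRing.isZmodule.Build Zp padic_addA padic_addC padic_add0 padic_addN.
HB.instance Definition _ := GRing.Zmodule_isComNzRing.Build Zp
  padic_mulA padic_mulC padic_mul1 padic_mulDl padic_1neq0.

Definition padic_unit : pred Zp := fun x => `[< exists y, y * x = 1 >].
Definition padic_inv x : Zp :=
  if pselect (exists y, y * x = 1) is left e then projT1 (cid e) else x.

Fact padic_mulV : {in padic_unit, left_inverse 1 padic_inv *%R}.
Proof.
move=> x /asboolP ux; rewrite /padic_inv; case: pselect => // e.
by case: (cid e).
Qed.
Fact padic_unitP x y : y * x = 1 -> padic_unit x.
Proof. by move=> xy; apply/asboolP; exists y. Qed.
Fact padic_inv_out : {in [predC padic_unit], padic_inv =1 id}.
Proof.
move=> x /asboolP nux; rewrite /padic_inv; case: pselect => // e.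
Qed.
HB.instance Definition _ := GRing.ComNzRing_hasMulInverse.Build Zp
  padic_mulV padic_unitP padic_inv_out.

Lemma padic_le x m n : (m <= n)%N ->
  (padic_res x m = padic_res x n %[mod p%:Z ^+ m])%Z.
Proof.
elim: n => [|n IHn]; first by rewrite leqn0 => /eqP ->.
rewrite leq_eqVlt => /predU1P[-> //|]; rewrite ltnS => le_mn; rewrite (IHn le_mn).
apply/eqP; rewrite eqz_mod_dvd; apply: (@dvdz_trans (p%:Z ^+ n)).
  by rewrite -(subnK le_mn) exprD dvdz_mull.
by rewrite -eqz_mod_dvd; apply/eqP; exact: padic_compat.
Qed.

Fact padic_mulf_eq0 x y : x * y = 0 -> (x == 0) || (y == 0).
Proof.
move=> xy0; apply/norP => -[/eqP x0 /eqP y0].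
have nz z : z <> 0 -> exists n, ~~ (p%:Z ^+ n %| padic_res z n)%Z.
  move=> z0; apply: contrapT => /forallNP Hn; apply: z0; apply: padic_inj => n.
  have /negP/negPn := Hn n; rewrite dvdzE => /dvdz_mod0P.
  by rewrite padic_mod /= mod0z.
have [m xm] := nz x x0; have [n yn] := nz y y0.
have up z j k : ~~ (p%:Z ^+ j %| padic_res z j)%Z ->
    ~~ (p%:Z ^+ j %| padic_res z (j + k)%N)%Z.
  apply: contra => /dvdz_mod0P jz; apply/dvdz_mod0P.
  by rewrite (padic_le z (leq_addr k j)).
have {xm}xm := up x m n xm; have {yn} := up y n m yn; rewrite addnC => yn.
have : (p%:Z ^+ (m + n) %| padic_res x (m + n) * padic_res y (m + n))%Z.
  apply/dvdz_mod0P; have := congr1 (fun z => padic_res z (m + n)) xy0.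
  by rewrite /= mod0z.
move: xm yn; rewrite !dvdzE !abszX !abszM !absz_nat => xm yn.
case: (posnP `|padic_res x (m + n)|) xm => [-> |a_gt0]; first by rewrite dvdn0.
case: (posnP `|padic_res y (m + n)|) yn => [-> |b_gt0]; first by rewrite dvdn0.
rewrite !pfactor_dvdn ?muln_gt0 ?a_gt0 // lognM // -!ltnNge => yn xm.
by rewrite leqNgt -addnS leq_add // ltnW.
Qed.
HB.instance Definition _ :=
  GRing.ComUnitRing_isIntegral.Build Zp padic_mulf_eq0.
End PadicInt.

Notation padic_num pp := {fraction (padic_int pp)}.

Section GroupAlgebra.
Variable A : comNzRingType.
Implicit Types gT hT : finGroupType.

Definition galg_pair gT (a : {ffun gT -> A}) (phi : gT -> A) : A :=
  \sum_x a x * phi x.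

Definition galg_mul gT (a b : {ffun gT -> A}) : {ffun gT -> A} :=
  [ffun x => \sum_y \sum_(z | (y * z)%g == x) a y * b z].

Definition galg_pt gT (g : gT) : {ffun gT -> A} := [ffun x => (x == g)%:R].

Definition galg_scale gT (c : A) (a : {ffun gT -> A}) : {ffun gT -> A} :=
  [ffun x => c * a x].

Definition galg_push gT hT (f : gT -> hT) (a : {ffun gT -> A}) :
    {ffun hT -> A} :=
  [ffun x => \sum_(y | f y == x) a y].

Lemma galg_ext gT (a b : {ffun gT -> A}) :
  (forall phi, galg_pair a phi = galg_pair b phi) -> a = b.
Proof.
move=> ab; apply/ffunP => x; have := ab (fun y => (y == x)%:R).
rewrite /galg_pair (bigD1 x) //= eqxx mulr1 big1 => [|y /negPf->]; last first.
  by rewrite mulr0.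
rewrite addr0 => ->; rewrite (bigD1 x) //= eqxx mulr1 big1 ?addr0 //.
by move=> y /negPf->; rewrite mulr0.
Qed.

Lemma galg_pair_push gT hT (f : gT -> hT) a phi :
  galg_pair (galg_push f a) phi = galg_pair a (phi \o f).
Proof.
rewrite /galg_pair [RHS](partition_big f xpredT) //=; apply: eq_bigr => x _.
by rewrite ffunE big_distrl; apply: eq_bigr => y /eqP ->.
Qed.

Lemma galg_pair_mul gT (a b : {ffun gT -> A}) phi :
  galg_pair (galg_mul a b) phi =
  galg_pair a (fun y => galg_pair b (fun z => phi (y * z)%g)).
Proof.
rewrite /galg_pair; under eq_bigr do rewrite ffunE big_distrl.
rewrite exchange_big; apply: eq_bigr => y _ /=; rewrite big_distrr /=.
rewrite [RHS](partition_big (fun z => y * z)%g xpredT) //=; apply: eq_bigr => x _.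
by rewrite big_distrl; apply: eq_bigr => z /eqP ->; rewrite /= mulrA.
Qed.

Lemma galg_pair_pt gT (g : gT) phi : galg_pair (galg_pt g) phi = phi g.
Proof.
rewrite /galg_pair (bigD1 g) //= ffunE eqxx mul1r big1 ?addr0 //.
by move=> x /negPf xg; rewrite ffunE xg mul0r.
Qed.

Lemma galg_pairD gT (a b : {ffun gT -> A}) phi :
  galg_pair (a + b) phi = galg_pair a phi + galg_pair b phi.
Proof.
by rewrite -big_split; apply: eq_bigr => x _; rewrite ffunE mulrDl.
Qed.

Lemma galg_pairN gT (a : {ffun gT -> A}) phi :
  galg_pair (- a) phi = - galg_pair a phi.
Proof. by rewrite -sumrN; apply: eq_bigr => x _; rewrite ffunE mulNr. Qed.

Lemma galg_pair0 gT phi : galg_pair (0 : {ffun gT -> A}) phi = 0.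
Proof. by apply: big1 => x _; rewrite ffunE mul0r. Qed.

Lemma galg_pairZ gT c (a : {ffun gT -> A}) phi :
  galg_pair (galg_scale c a) phi = c * galg_pair a phi.
Proof. by rewrite big_distrr; apply: eq_bigr => x _; rewrite ffunE /= mulrA. Qed.

Lemma galg_pair_addr gT (a : {ffun gT -> A}) phi psi :
  galg_pair a (fun x => phi x + psi x) = galg_pair a phi + galg_pair a psi.
Proof. by rewrite -big_split; apply: eq_bigr => x _; rewrite mulrDr. Qed.

Definition galgE :=
  (galg_pair_push, galg_pair_mul, galg_pair_pt, galg_pairD, galg_pairN,
   galg_pair0, galg_pairZ, galg_pair_addr).

Lemma galg_mulA gT : associative (@galg_mul gT).
Proof.
move=> a b c; apply: galg_ext => phi; rewrite !galgE.
congr galg_pair; apply/funext => y; rewrite !galgE.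
by congr galg_pair; apply/funext => z; under eq_fun do rewrite mulgA.
Qed.

Lemma galg_mul1 gT : left_id (galg_pt 1%g) (@galg_mul gT).
Proof.
move=> a; apply: galg_ext => phi; rewrite !galgE.
by under eq_fun do rewrite mul1g.
Qed.

Lemma galg_1mul gT : right_id (galg_pt 1%g) (@galg_mul gT).
Proof.
move=> a; apply: galg_ext => phi; rewrite !galgE.
by congr galg_pair; apply/funext => y; rewrite galgE mulg1.
Qed.

Lemma galg_mulDl gT : left_distributive (@galg_mul gT) +%R.
Proof. by move=> a b c; apply: galg_ext => phi; rewrite !galgE. Qed.

Lemma galg_mulDr gT : right_distributive (@galg_mul gT) +%R.
Proof.
move=> a b c; apply: galg_ext => phi; rewrite !galgE -galg_pair_addr.
by congr galg_pair; apply/funext => y; rewrite !galgE.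
Qed.

Lemma galg_pushM gT hT (f : gT -> hT) :
  {morph f : x y / (x * y)%g} -> {morph galg_push f : a b / galg_mul a b}.
Proof.
move=> fM a b; apply: galg_ext => phi; rewrite !galgE.
congr galg_pair; apply/funext => y; rewrite /= !galgE.
by congr galg_pair; apply/funext => z; rewrite /= fM.
Qed.

Lemma galg_push_pt gT hT (f : gT -> hT) g :
  galg_push f (galg_pt g) = galg_pt (f g).
Proof. by apply: galg_ext => phi; rewrite !galgE. Qed.

Lemma galg_pushD gT hT (f : gT -> hT) : {morph galg_push f : a b / a + b}.
Proof. by move=> a b; apply: galg_ext => phi; rewrite !galgE. Qed.

Lemma galg_pushN gT hT (f : gT -> hT) : {morph galg_push f : a / - a}.
Proof. by move=> a; apply: galg_ext => phi; rewrite !galgE. Qed.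

Lemma galg_push0 gT hT (f : gT -> hT) : galg_push f 0 = 0.
Proof. by apply: galg_ext => phi; rewrite !galgE. Qed.

Lemma galg_pushZ gT hT (f : gT -> hT) c :
  {morph galg_push f : a / galg_scale c a}.
Proof. by move=> a; apply: galg_ext => phi; rewrite !galgE. Qed.
End GroupAlgebra.

(* A profinite group presented as the inverse limit of its finite quotients.  *)
Record tower := Tower {
  level :> nat -> finGroupType;
  trans : forall n, level n.+1 -> level n;
  transM : forall n, {morph @trans n : x y / (x * y)%g} }.

Lemma trans1 (T : tower) n : trans (1%g : T n.+1) = 1%g.
Proof. by apply: (mulgI (trans 1%g)); rewrite -transM !mulg1. Qed.

(* The completed group algebra A[[lim T]] = lim A[T n].                        *)
Record iwasawa (A : comNzRingType) (T : tower) := Iwasawa {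
  iw_comp :> forall n, {ffun T n -> A};
  iw_compP : forall n, iw_comp n = galg_push (@trans T n) (iw_comp n.+1) }.

HB.instance Definition _ A T := gen_eqMixin (iwasawa A T).
HB.instance Definition _ A T := gen_choiceMixin (iwasawa A T).

Section IwasawaAlgebra.
Variables (A : comNzRingType) (T : tower).
Local Notation Lambda := (iwasawa A T).
Implicit Types a b c : Lambda.

Lemma iwasawa_inj a b : (forall n, a n = b n) -> a = b.
Proof.
case: a b => [f fP] [g gP] /= fg.
have {}fg : f = g by apply: functional_extensionality_dep.
by subst g; congr Iwasawa; apply: Prop_irrelevance.
Qed.

Program Definition iwasawa_zero : Lambda := @Iwasawa A T (fun n => 0) _.
Next Obligation. by rewrite galg_push0. Qed.
Program Definition iwasawa_add a b : Lambda :=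
  @Iwasawa A T (fun n => a n + b n) _.
Next Obligation. by rewrite galg_pushD -!iw_compP. Qed.
Program Definition iwasawa_opp a : Lambda := @Iwasawa A T (fun n => - a n) _.
Next Obligation. by rewrite galg_pushN -iw_compP. Qed.
Program Definition iwasawa_mul a b : Lambda :=
  @Iwasawa A T (fun n => galg_mul (a n) (b n)) _.
Next Obligation. by rewrite (galg_pushM (@transM T n)) -!iw_compP. Qed.
Program Definition iwasawa_scale (x : A) a : Lambda :=
  @Iwasawa A T (fun n => galg_scale x (a n)) _.
Next Obligation. by rewrite galg_pushZ -iw_compP. Qed.
Program Definition iwasawa_pt (g : forall n, T n)
    (gP : forall n, trans (g n.+1) = g n) : Lambda :=
  @Iwasawa A T (fun n => galg_pt A (g n)) _.
Next Obligation. by rewrite galg_push_pt gP. Qed.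
Definition iwasawa_one : Lambda :=
  @iwasawa_pt (fun=> 1%g) (fun n => trans1 T n).

Fact iwasawa_addA : associative iwasawa_add.
Proof. by move=> a b c; apply: iwasawa_inj => n; apply: addrA. Qed.
Fact iwasawa_addC : commutative iwasawa_add.
Proof. by move=> a b; apply: iwasawa_inj => n; apply: addrC. Qed.
Fact iwasawa_add0 : left_id iwasawa_zero iwasawa_add.
Proof. by move=> a; apply: iwasawa_inj => n; apply: add0r. Qed.
Fact iwasawa_addN : left_inverse iwasawa_zero iwasawa_opp iwasawa_add.
Proof. by move=> a; apply: iwasawa_inj => n; apply: addNr. Qed.
Fact iwasawa_mulA : associative iwasawa_mul.
Proof. by move=> a b c; apply: iwasawa_inj => n; apply: galg_mulA. Qed.
Fact iwasawa_mul1 : left_id iwasawa_one iwasawa_mul.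
Proof. by move=> a; apply: iwasawa_inj => n; apply: galg_mul1. Qed.
Fact iwasawa_1mul : right_id iwasawa_one iwasawa_mul.
Proof. by move=> a; apply: iwasawa_inj => n; apply: galg_1mul. Qed.
Fact iwasawa_mulDl : left_distributive iwasawa_mul iwasawa_add.
Proof. by move=> a b c; apply: iwasawa_inj => n; apply: galg_mulDl. Qed.
Fact iwasawa_mulDr : right_distributive iwasawa_mul iwasawa_add.
Proof. by move=> a b c; apply: iwasawa_inj => n; apply: galg_mulDr. Qed.

HB.instance Definition _ := GRing.isZmodule.Build Lambda
  iwasawa_addA iwasawa_addC iwasawa_add0 iwasawa_addN.
HB.instance Definition _ := GRing.Zmodule_isPzRing.Build Lambda
  iwasawa_mulA iwasawa_mul1 iwasawa_1mul iwasawa_mulDl iwasawa_mulDr.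

Fact iwasawa_scaleA x y a :
  iwasawa_scale x (iwasawa_scale y a) = iwasawa_scale (x * y) a.
Proof. by apply: iwasawa_inj => n; apply/ffunP => g; rewrite !ffunE mulrA. Qed.
Fact iwasawa_scale1 : left_id 1 iwasawa_scale.
Proof. by move=> a; apply: iwasawa_inj => n; apply/ffunP => g; rewrite !ffunE mul1r. Qed.
Fact iwasawa_scaleDr : right_distributive iwasawa_scale +%R.
Proof.
by move=> x a b; apply: iwasawa_inj => n; apply/ffunP => g; rewrite !ffunE mulrDr.
Qed.
Fact iwasawa_scaleDl a : {morph iwasawa_scale^~ a : x y / x + y}.
Proof.
by move=> x y; apply: iwasawa_inj => n; apply/ffunP => g; rewrite !ffunE mulrDl.
Qed.
HB.instance Definition _ := GRing.Zmodule_isLmodule.Build A Lambda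
  iwasawa_scaleA iwasawa_scale1 iwasawa_scaleDr iwasawa_scaleDl.

(* The measures supported on the closed subgroup cut out by the subsets S n:   *)
(* its own completed group algebra, inside A[[lim T]].                         *)
Definition supported (S : forall n, {set T n}) a :=
  forall n x, x \notin S n -> a n x = 0.
End IwasawaAlgebra.

Section RingOfIntegers.
Variables (p : nat) (pp : prime p) (E : fieldExtType (padic_num pp)).

Definition padic_emb : {rmorphism padic_int pp -> E} :=
  in_alg E \o @tofrac (padic_int pp).

Definition is_integral : {pred E} := fun x => `[< integralOver padic_emb x >].

Fact is_integral_subring : subring_closed is_integral.
Proof.
split=> [|x y /asboolP ix /asboolP iy|x y /asboolP ix /asboolP iy].
- by apply/asboolP; apply: integral1.
- by apply/asboolP; apply: integral_sub.
- by apply/asboolP; apply: integral_mul.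
Qed.
HB.instance Definition _ :=
  GRing.isSubringClosed.Build E is_integral is_integral_subring.

Record integers := Integers { int_val :> E; int_valP : int_val \in is_integral }.

HB.instance Definition _ := [isSub for int_val].
HB.instance Definition _ := [Choice of integers by <:].
HB.instance Definition _ := [SubChoice_isSubComNzRing of integers by <:].

Fact padic_emb_integral x : padic_emb x \in is_integral.
Proof. by apply/asboolP; apply: integral_id. Qed.

Definition padic_integer (x : padic_int pp) : integers :=
  Integers (padic_emb_integral x).

Fact padic_integer_is_zmod_morphism : zmod_morphism padic_integer.
Proof. by move=> x y; apply: val_inj; apply: (rmorphB padic_emb). Qed.
Fact padic_integer_is_monoid_morphism : monoid_morphism padic_integer.
Proof.
split=> [|x y]; apply: val_inj; first exact: (rmorph1 padic_emb).
exact: (rmorphM padic_emb).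
Qed.
HB.instance Definition _ := GRing.isZmodMorphism.Build (padic_int pp) integers
  padic_integer padic_integer_is_zmod_morphism.
HB.instance Definition _ := GRing.isMonoidMorphism.Build (padic_int pp) integers
  padic_integer padic_integer_is_monoid_morphism.
End RingOfIntegers.

Definition has_inv (R : pzRingType) (x : R) := exists y, y * x = 1.

Definition divides (R : comPzRingType) (x y : R) := exists z, y = x * z.

Lemma intr_modz (R : nzRingType) (a d : int) :
  d%:~R = 0 :> R -> (a %% d)%Z%:~R = a%:~R :> R.
Proof.
by move=> d0; rewrite [in RHS](divz_eq a d) [RHS]intrD intrM d0 mulr0 add0r.
Qed.

Definition level_trans (p : nat) (pp : prime p) n (x : 'Z_(p ^ n.+2)) :
  'Z_(p ^ n.+1) := (x : nat)%:R.

Section Levels.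
Variables (p : nat) (pp : prime p).
Local Notation Zp := (padic_int pp).

Lemma level_gt1 n : (1 < p ^ n.+1)%N.
Proof. by rewrite -(exp1n n.+1) ltn_exp2r // prime_gt1. Qed.

(* Reduction Z_p -> Z/p^k into any ring killed by p^k, read off from the k-th  *)
(* component.                                                                  *)
Definition padic_red (R : nzRingType) (k : nat) (x : Zp) : R :=
  (padic_res x k)%:~R.

Lemma padic_red_morphism (R : nzRingType) k : (p ^ k)%:R = 0 :> R ->
  zmod_morphism (@padic_red R k) * monoid_morphism (@padic_red R k).
Proof.
rewrite natrX => pk0.
have pk : (p%:Z ^+ k)%:~R = 0 :> R by rewrite rmorphXn.
split; first by move=> x y; rewrite /padic_red /= !intr_modz // rmorphD /=
  intr_modz // rmorphN.
split=> [|x y]; first by rewrite /padic_red /= intr_modz.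
by rewrite /padic_red /= intr_modz // intrM.
Qed.

Definition modp_red : Zp -> 'F_p := @padic_red 'F_p 1.
Definition level_red n : Zp -> 'Z_(p ^ n.+1) := @padic_red 'Z_(p ^ n.+1) n.+1.

Fact modp_zero : (p ^ 1)%:R = 0 :> 'F_p.
Proof. by rewrite expn1 pchar_Fp_0. Qed.
Fact level_zero n : (p ^ n.+1)%:R = 0 :> 'Z_(p ^ n.+1).
Proof. exact/pchar_Zp/level_gt1. Qed.

HB.instance Definition _ := GRing.isZmodMorphism.Build Zp 'F_p modp_red
  (padic_red_morphism modp_zero).1.
HB.instance Definition _ := GRing.isMonoidMorphism.Build Zp 'F_p modp_red
  (padic_red_morphism modp_zero).2.
HB.instance Definition _ n := GRing.isZmodMorphism.Build
  Zp 'Z_(p ^ n.+1) (level_red n) (padic_red_morphism (level_zero n)).1.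
HB.instance Definition _ n := GRing.isMonoidMorphism.Build
  Zp 'Z_(p ^ n.+1) (level_red n) (padic_red_morphism (level_zero n)).2.

Fact natr_level n (a : nat) :
  (a %% p ^ n.+2)%:R = a%:R :> 'Z_(p ^ n.+1).
Proof.
have z : (p ^ n.+2)%:R = 0 :> 'Z_(p ^ n.+1).
  by rewrite [(p ^ n.+2)%N]expnS natrM level_zero mulr0.
by rewrite {2}(divn_eq a (p ^ n.+2)) natrD natrM z mulr0 add0r.
Qed.

Lemma level_trans_nat n a : level_trans pp (a%:R : 'Z_(p ^ n.+2)) = a%:R.
Proof. by rewrite /level_trans val_Zp_nat ?level_gt1 // natr_level. Qed.

Fact level_transD n : {morph @level_trans p pp n : x y / x + y}.
Proof.
by move=> x y; rewrite -[x]natr_Zp -[y]natr_Zp -natrD !level_trans_nat natrD.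
Qed.
Fact level_transB n : zmod_morphism (@level_trans p pp n).
Proof.
by move=> x y; apply/eqP; rewrite eq_sym subr_eq -level_transD subrK.
Qed.
Fact level_transM n : monoid_morphism (@level_trans p pp n).
Proof.
split=> [|x y]; first exact: (level_trans_nat n 1).
by rewrite -[x]natr_Zp -[y]natr_Zp -natrM !level_trans_nat natrM.
Qed.
HB.instance Definition _ n := GRing.isZmodMorphism.Build
  'Z_(p ^ n.+2) 'Z_(p ^ n.+1) (@level_trans p pp n) (@level_transB n).
HB.instance Definition _ n := GRing.isMonoidMorphism.Build
  'Z_(p ^ n.+2) 'Z_(p ^ n.+1) (@level_trans p pp n) (@level_transM n).

Lemma level_trans_red n x : level_trans pp (level_red n.+1 x) = level_red n x.
Proof.
rewrite /level_red /padic_red (padic_resP x n.+1) intr_modz; last first.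
  by rewrite rmorphXn /= -natrX level_zero.
case: (padic_res x n.+2) => m; first exact: (level_trans_nat n m).
rewrite NegzE !mulrNz rmorphN; congr (- _); exact: (level_trans_nat n m.+1).
Qed.
End Levels.

Section UnitMap.
Variables (R S : finUnitRingType) (f : {rmorphism R -> S}).
Definition unit_map (u : {unit R}) : {unit S} :=
  FinRing.unit S (rmorph_unit f (valP u)).
Lemma unit_mapM : {morph unit_map : u v / (u * v)%g}.
Proof. by move=> u v; apply: val_inj; apply: rmorphM. Qed.
End UnitMap.

Section Towers.
Variables (p : nat) (pp : prime p).
Local Notation Zp := (padic_int pp).
Implicit Types g : 'M[Zp]_2.

(* 1 + p Z_p = lim of its images in (Z/p^(n+1))^*.                             *)
Definition Gamma_level n : {set {unit 'Z_(p ^ n.+1)}} :=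
  [set u : {unit 'Z_(p ^ n.+1)} | ((FinRing.uval u : nat) == 1 %[mod p])%N].

Fact Gamma_level_group_set n : group_set (Gamma_level n).
Proof.
have p_dvd : (p %| (Zp_trunc (p ^ n.+1)).+2)%N.
  by rewrite Zp_cast ?level_gt1 // expnS dvdn_mulr.
apply/group_setP; split=> [|u v]; rewrite !inE; first by [].
by rewrite /= modn_dvdm // -modnMm => /eqP-> /eqP->; rewrite modnMm.
Qed.
Canonical Gamma_group n := Group (Gamma_level_group_set n).

Fact Gamma_trans_in n (x : [subg Gamma_group n.+1]) :
  unit_map (@level_trans p pp n) (sgval x) \in Gamma_group n.
Proof.
have p_dvd : (p %| p ^ n.+1)%N by rewrite expnS dvdn_mulr.
have := subgP x; rewrite !inE /= /level_trans => /eqP xP.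
by rewrite val_Zp_nat ?level_gt1 // modn_dvdm // xP.
Qed.

Definition Gamma_trans n (x : [subg Gamma_group n.+1]) :
  [subg Gamma_group n] := Subg (Gamma_trans_in x).

Fact Gamma_transM n : {morph @Gamma_trans n : x y / (x * y)%g}.
Proof. by move=> x y; apply: val_inj; apply: unit_mapM. Qed.

Definition Gamma_tower : tower := Tower Gamma_transM.

(* Image of x in the n-th level; only meaningful for x in 1 + p Z_p.           *)
Definition Gamma_pt n (x : Zp) : [subg Gamma_group n] :=
  subg (Gamma_group n)
    (if modp_red x == 1 then
       insubd (1%g : {unit 'Z_(p ^ n.+1)}) (level_red n x)
     else 1%g).

(* K = GL_2(Z_p) = lim GL_2(Z/p^(n+1)).                                        *)
Definition K_tower : tower :=
  @Tower (fun n => {'GL_2['Z_(p ^ n.+1)]})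
    (fun n => unit_map (map_mx (@level_trans p pp n)))
    (fun n => unit_mapM _).

(* Image of g in GL_2(R) for a ring map f : Z_p -> R; only meaningful (and     *)
(* only used) for g in GL_2(Z_p), the value elsewhere is junk.                 *)
Definition GL_red (R : finComUnitRingType) (f : Zp -> R) g : {'GL_2[R]} :=
  if g \in unitmx then insubd (1%g : {'GL_2[R]}) (map_mx f g) else 1%g.

Fact K_pt_compat g n : @trans K_tower n (GL_red (level_red n.+1) g) =
                       GL_red (level_red n) g.
Proof.
rewrite /GL_red; case: ifP => ug; last exact: (trans1 K_tower n).
have im m : map_mx (@level_red p pp m) g \is a GRing.unit.
  by apply: (rmorph_unit (map_mx (@level_red p pp m))).
apply: val_inj; rewrite /= !val_insubd !im -map_mx_comp.
by apply/matrixP => i j; rewrite !mxE /= level_trans_red.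
Qed.

Definition K_dirac (A : comNzRingType) g : iwasawa A K_tower :=
  iwasawa_pt A (K_pt_compat g).

Lemma level_red_1modp n (x : Zp) : modp_red x = 1 ->
  (level_red n x \is a GRing.unit) /\ (level_red n x = 1 %[mod p])%N.
Proof.
move=> x1; rewrite /level_red /padic_red.
have [m mE] : exists m : nat, padic_res x n.+1 = m%:Z.
  exists `|padic_res x n.+1|%N; rewrite -[in LHS]padic_mod gez0_abs ?modz_ge0 //.
    by rewrite -[in RHS]padic_mod.
  by rewrite -padic_mod modz_ge0 // expf_neq0 // -lt0n prime_gt0.
have m1 : (m = 1 %[mod p])%N.
  have: m%:R = 1%:R :> 'F_p.
    rewrite -[RHS]x1 /modp_red /padic_red -(padic_mod x 1) (padic_le x (ltn0Sn n)).
    by rewrite intr_modz ?mE //; apply: (pchar_Fp_0 pp).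
  by move/(congr1 (@nat_of_ord _)); rewrite -[1]/(1%:R : 'F_p) !val_Fp_nat.
rewrite mE -pmulrn val_Zp_nat ?level_gt1 // modn_dvdm ?expnS ?dvdn_mulr //.
split=> //; rewrite -expnS unitZpE ?level_gt1 // coprimeXl // coprime_sym.
by rewrite -coprime_modl m1 coprime_modl coprime1n.
Qed.

Fact Gamma_pt_compat x n : @trans Gamma_tower n (Gamma_pt n.+1 x) = Gamma_pt n x.
Proof.
have in_Gamma m : (if modp_red x == 1 then
    insubd (1%g : {unit 'Z_(p ^ m.+1)}) (level_red m x) else 1%g)
  \in Gamma_group m.
  case: eqP => [/(level_red_1modp m)[ux x1]|_]; last exact: group1.
  by rewrite inE -/(val _) val_insubd ux x1.
apply: val_inj; rewrite /= /Gamma_pt !subgK; try exact: in_Gamma.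
case: eqP => [x1|_]; last by apply: val_inj; apply: rmorph1.
have ux m := (level_red_1modp m x1).1.
by apply: val_inj; rewrite /= -!/(val _) !val_insubd !ux level_trans_red.
Qed.

Definition Gamma_dirac (A : comNzRingType) x : iwasawa A Gamma_tower :=
  iwasawa_pt A (Gamma_pt_compat x).
End Towers.
(* A right A[[lim T]]-module H is a left module over the converse ring; this   *)
(* is H seen as an A-module.                                                   *)
Definition coef_mod (A : comNzRingType) (T : tower)
  (H : lmodType (iwasawa A T)^c) : Type := H.

Section CoefMod.
Variables (A : comNzRingType) (T : tower) (H : lmodType (iwasawa A T)^c).

HB.instance Definition _ := GRing.Zmodule.copy (coef_mod H) H.

Definition iwasawa_const (a : A) : iwasawa A T := a *: (1 : iwasawa A T).

Definition coef_scale (a : A) (x : coef_mod H) : coef_mod H :=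
  (iwasawa_const a : (iwasawa A T)^c) *: (x : H).

Fact iwasawa_constM (a b : A) :
  iwasawa_const a * iwasawa_const b = iwasawa_const (a * b).
Proof.
apply: iwasawa_inj => n; apply: galg_ext => phi.
by rewrite /= !galgE mul1g mulrA.
Qed.

Fact coef_scaleA a b x : coef_scale a (coef_scale b x) = coef_scale (a * b) x.
Proof.
by rewrite /coef_scale scalerA mulrC -iwasawa_constM.
Qed.
Fact coef_scale1 : left_id 1 coef_scale.
Proof. by move=> x; rewrite /coef_scale /iwasawa_const scale1r [LHS]scale1r. Qed.
Fact coef_scaleDr : right_distributive coef_scale +%R.
Proof. by move=> a x y; rewrite /coef_scale [LHS]scalerDr. Qed.
Fact coef_scaleDl x : {morph coef_scale^~ x : a b / a + b}.
Proof.
by move=> a b; rewrite /coef_scale /iwasawa_const scalerDl [LHS]scalerDl.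
Qed.
HB.instance Definition _ := GRing.Zmodule_isLmodule.Build A (coef_mod H)
  coef_scaleA coef_scale1 coef_scaleDr coef_scaleDl.
End CoefMod.

Section Modules.
Variable R : pzRingType.
Implicit Types M N P Q : lmodType R.

Definition submodule M (U : set M) :=
  U 0 /\ forall a x y, U x -> U y -> U (a *: x + y).

Definition finitely_generated M :=
  exists n (e : 'I_n -> M), forall x, exists c : 'I_n -> R,
    x = \sum_i c i *: e i.

Definition projective P :=
  forall M N (f : {linear M -> N}) (g : {linear P -> N}),
    (forall y, exists x, f x = y) ->
    exists h : {linear P -> M}, forall x, f (h x) = g x.

(* Linear topologies with a countable basis of neighbourhoods of 0.            *)
Definition filtration M (F : nat -> set M) :=
  (forall n, submodule (F n)) /\ forall n x, F n.+1 x -> F n x.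

(* M -> lim M / F n is bijective.                                              *)
Definition complete_filtration M (F : nat -> set M) :=
  filtration F /\ (forall x, (forall n, F n x) -> x = 0) /\
  forall u : nat -> M, (forall n, F n (u n.+1 - u n)) ->
    exists x, forall n, F n (x - u n).

Definition filtered_continuous M N (F : nat -> set M) (G : nat -> set N)
  (f : M -> N) := forall n, exists m, forall x, F m x -> G n (f x).

Definition bilinear M N Q (b : M -> N -> Q) :=
  (forall a x x' y, b (a *: x + x') y = a *: b x y + b x' y) /\
  (forall a x y y', b x (a *: y + y') = a *: b x y + b x y').

(* b induces, for every n, a map on some M / F m (x) N / G m with values in    *)
(* Q / H n.                                                                    *)
Definition bicontinuous M N Q (F : nat -> set M) (G : nat -> set N)
    (H : nat -> set Q) (b : M -> N -> Q) :=
  forall n, exists m,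
    (forall x y, F m x -> H n (b x y)) /\ (forall x y, G m y -> H n (b x y)).

(* tau exhibits Q as the completed tensor product lim_m (M/F m (x) N/G m),     *)
(* through the universal property of the latter among complete modules.        *)
Definition completed_tensor M N Q (F : nat -> set M) (G : nat -> set N)
    (H : nat -> set Q) (tau : M -> N -> Q) :=
  [/\ complete_filtration H, bilinear tau, bicontinuous F G H tau &
    forall (Q' : lmodType R) (H' : nat -> set Q') (b : M -> N -> Q'),
      complete_filtration H' -> bilinear b -> bicontinuous F G H' b ->
      exists f : {linear Q -> Q'},
        [/\ filtered_continuous H H' f, forall x y, f (tau x y) = b x y &
          forall f' : {linear Q -> Q'}, filtered_continuous H H' f' ->
            (forall x y, f' (tau x y) = b x y) -> f' =1 f]].

Definition independent M n (b : 'I_n -> M) :=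
  forall c : 'I_n -> R, \sum_i c i *: b i = 0 -> forall i, c i = 0.

(* The rank over a domain: the largest size of a linearly independent family.  *)
Definition has_rank M (U : set M) (d : nat) :=
  (exists b : 'I_d -> M, (forall i, U (b i)) /\ independent b) /\
  (forall b : 'I_d.+1 -> M, (forall i, U (b i)) -> ~ independent b).

Definition rank M (U : set M) : nat := xget 0%N [set d | has_rank U d].
End Modules.

Section FiniteGroupModules.
Variables (F : fieldType) (gT : finGroupType).

(* Right F[gT]-modules, as F-linear right actions.                             *)
Definition is_rep (V : lmodType F) (act : V -> gT -> V) :=
  [/\ forall v, act v 1%g = v,
      forall v g h, act (act v g) h = act v (g * h)%g &
      forall a v w g, act (a *: v + w) g = a *: act v g + act w g].

Definition equivariant (V W : lmodType F) (actV : V -> gT -> V)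
  (actW : W -> gT -> W) (f : V -> W) :=
  forall v g, f (actV v g) = actW (f v) g.

Definition projective_rep (P : lmodType F) (actP : P -> gT -> P) :=
  forall (V W : lmodType F) actV actW
         (f : {linear V -> W}) (g : {linear P -> W}),
    is_rep actV -> is_rep actW ->
    equivariant actV actW f -> equivariant actP actW g ->
    (forall w, exists v, f v = w) ->
    exists h : {linear P -> V}, equivariant actP actV h /\
                                forall x, f (h x) = g x.

(* P is the projective envelope (cover) of S.                                  *)
Definition projective_envelope (P S : lmodType F) (actP : P -> gT -> P)
    (actS : S -> gT -> S) :=
  [/\ is_rep actP, is_rep actS, projective_rep actP &
    exists f : {linear P -> S},
      [/\ equivariant actP actS f, forall y, exists x, f x = y &
        forall U : set P, submodule U -> (forall x g, U x -> U (actP x g)) ->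
          (forall y, exists x, U x /\ f x = y) -> forall x, U x]].
End FiniteGroupModules.

Definition mx2 (R : Type) (a b c d : R) : 'M[R]_2 :=
  \matrix_(i < 2, j < 2)
    (if i == 0 :> nat then if j == 0 :> nat then a else b
     else if j == 0 :> nat then c else d).

(* (c z + d)^m h((a z + b)/(c z + d)) for deg h <= m. Writing z = x / y with   *)
(* x = (1, 0) and y = (0, 1), this is the right action of GL_2 on the m-th      *)
(* symmetric power of the space of row vectors.                                 *)
Definition slash (R : comNzRingType) (m : nat) (g : 'M[R]_2)
    (h : {poly_m.+1 R}) : {poly_m.+1 R} :=
  npolyp m.+1 (\sum_(i < m.+1) (h : {poly R})`_i *:
    ((g 0 0 *: 'X + (g 0 1)%:P) ^+ i * (g 1 0 *: 'X + (g 1 1)%:P) ^+ (m - i))).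

Section Setting.
Variables (p : nat) (pp : prime p) (E : fieldExtType (padic_num pp)).
Local Notation Zp := (padic_int pp).
Local Notation Qp := (padic_num pp).
Local Notation O := (integers E).
Local Notation K_tower := (K_tower pp).
Local Notation Gamma_tower := (Gamma_tower pp).
Local Notation Lambda := (iwasawa O K_tower).
Local Notation GL2Fp := {'GL_2['F_p]}.

Definition padic_mx (g : 'M[Zp]_2) : 'M[Qp]_2 := map_mx (@tofrac _) g.

Definition Iw (g : 'M[Zp]_2) := g \in unitmx /\ modp_red (g 1 0) = 0.

(* g = 1 mod p^m                                                               *)
Definition congruent1 m (g : 'M[Zp]_2) :=
  forall i j, divides (p%:R ^+ m) ((g - 1%:M) i j).

Definition Delta2 (g : 'M[Zp]_2) :=
  [/\ g \in unitmx, is_diag_mx g & exists2 n, (0 < n)%N & g ^+ n = 1].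

Definition Iw_level n : {set K_tower n} :=
  [set x : {'GL_2['Z_(p ^ n.+1)]} | (p %| (GLval x 1%R 0%R : nat))%N].

(* The pro-p Sylow of Iw: diagonal entries congruent to 1 mod p.               *)
Definition I1_level n : {set K_tower n} :=
  [set x : {'GL_2['Z_(p ^ n.+1)]} |
    [&& (p %| (GLval x 1%R 0%R : nat))%N,
        ((GLval x 0%R 0%R : nat) == 1 %[mod p])%N &
        ((GLval x 1%R 1%R : nat) == 1 %[mod p])%N]].

(* The topology of O[[lim T]]: kernels of the maps to (O/p^n)[T n].            *)
Definition iwasawa_filtration (T : tower) (n : nat) : set (iwasawa O T) :=
  [set mu : iwasawa O T | forall x, divides (p%:R ^+ n) (mu n x)].

Section Module.
Variables (F : fieldType) (red : {rmorphism O -> F}) (varpi : O).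
Variables (H : lmodType Lambda^c) (act : coef_mod H -> 'M[Qp]_2 -> coef_mod H).

Definition uniformizer :=
  ~ has_inv varpi /\ forall a : O, ~ has_inv a -> divides varpi a.

Definition residue_map :=
  (forall y, exists x, red x = y) /\ forall x, red x = 0 <-> divides varpi x.

(* The topology of a finitely generated O[[K]]-module.                         *)
Definition module_filtration (n : nat) : set (coef_mod H) :=
  [set x | exists r (mu : 'I_r -> Lambda) (y : 'I_r -> H),
    (forall i, iwasawa_filtration n (mu i)) /\
    x = \sum_i (mu i : Lambda^c) *: y i].

Section Action.
Variables (M : lmodType O) (G : nat -> set M) (a : M -> 'M[Qp]_2 -> M).
Definition GL2_action :=
  [/\ forall x, a x 1%:M = x,
      forall x g h, g \in unitmx -> h \in unitmx ->
        a (a x g) h = a x (g *m h) &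
      forall c x y g, g \in unitmx -> a (c *: x + y) g = c *: a x g + a y g].

Definition GL2_continuous :=
  forall x g n, g \in unitmx -> exists m, forall x' k,
    G m (x' - x) -> k \in unitmx -> congruent1 m k ->
    G n (a x' (g *m padic_mx k) - a x g).
End Action.

(* gamma is the projection of x to the third factor of                         *)
(* Q_p^* = p^Z x mu_(p-1) x (1 + p Z_p).                                       *)
Definition proj_1units (x : Qp) (gamma : Zp) :=
  modp_red gamma = 1 /\
  exists (i : int) (zeta : Zp),
    zeta ^+ p.-1 = 1 /\ x = (p%:R : Qp) ^ i * tofrac (zeta * gamma).

Definition Sym_act (m : nat) (v : {poly_m.+1 F}) (g : GL2Fp) :=
  slash (map_mx (fun x : 'F_p => (x : nat)%:R) (GLval g)) v.

Definition reduction_condition :=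
  exists (P : lmodType F) (actP : P -> GL2Fp -> P) (q : coef_mod H -> P),
  [/\ forall c x y, q (c *: x + y) = red c *: q x + q y,
      forall x g, g \in unitmx ->
        q ((K_dirac O g : Lambda^c) *: (x : H)) =
        actP (q x) (GL_red (@modp_red p pp) g),
      forall y, exists x, q x = y,
      forall x, q x = 0 <-> forall U : set H, submodule U ->
        (forall y : coef_mod H, U (varpi *: y)) ->
        (forall (y : H) g, g \in unitmx -> congruent1 1 g ->
           U ((K_dirac O g : Lambda^c) *: y - y)) -> U x &
      projective_envelope actP (@Sym_act p.-1)].

Definition tensor_condition :=
  exists (H0 : lmodType O) (G0 : nat -> set H0) (act0 : H0 -> 'M[Qp]_2 -> H0)
         (tau : H0 -> iwasawa O Gamma_tower -> coef_mod H),
  [/\ complete_filtration G0,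
      GL2_action act0 /\ GL2_continuous G0 act0,
      forall (x : H0) (gamma : Zp), modp_red gamma = 1 ->
        act0 x (tofrac gamma)%:M = x,
      completed_tensor G0 (@iwasawa_filtration Gamma_tower)
        module_filtration tau &
      forall x mu g gamma, g \in unitmx -> proj_1units (\det g) gamma ->
        tau (act0 x g) (mu * Gamma_dirac O gamma) = act (tau x mu) g].

Record primitive_module : Prop := PrimitiveModule {
  prim_fingen : @finitely_generated Lambda^c H;
  prim_proj : @projective Lambda^c H;
  prim_action : GL2_action act;
  prim_continuous : GL2_continuous module_filtration act;
  prim_extends : forall (x : H) g, g \in unitmx ->
    act x (padic_mx g) = (K_dirac O g : Lambda^c) *: x;
  prim_reduction : reduction_condition;
  prim_scalar : exists2 c : O, has_inv c & forall x, act x p%:R%:M = c *: x;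
  prim_tensor : tensor_condition }.

Definition normalized_module :=
  (forall x, act x p%:R%:M = x) /\
  exists e : H,
    [/\ forall x : H, exists! mu : Lambda,
          supported I1_level mu /\ x = (mu : Lambda^c) *: e,
        forall g, Delta2 g -> act e (padic_mx g) = e &
        act e (mx2 0 1 p%:R 0) = - (e : coef_mod H)].

Definition teichmuller (a : 'F_p) : Zp :=
  xget 0 [set x | x ^+ p.-1 = 1 /\ modp_red x = a].

(* omega^i x omega^j                                                           *)
Definition omega_char (i j : int) (a b : 'F_p) : O :=
  padic_integer E (teichmuller a ^ i * teichmuller b ^ j).

Section Iwahori.
Variables (psi : 'F_p -> 'F_p -> O) (m : nat).

Definition Iw_slash (g : 'M[Zp]_2) (h : {poly_m.+1 O}) : {poly_m.+1 O} :=
  psi (modp_red (\det g) / modp_red (g 1 1)) (modp_red (g 1 1)) *: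
  slash (map_mx (padic_integer E) g) h.

(* w = v mu, for the O[[Iw]]-module structure extending the continuous action  *)
(* of Iw: w is the limit of the Riemann sums of g |-> v|g against mu.          *)
Definition Iw_integral (v : {poly_m.+1 O}) (mu : Lambda) (w : {poly_m.+1 O}) :=
  forall N, exists n0, forall n (s : K_tower n -> 'M[Zp]_2), (n0 <= n)%N ->
    (forall x, x \in Iw_level n ->
       Iw (s x) /\ GL_red (@level_red p pp n) (s x) = x) ->
    forall i, divides (p%:R ^+ N)
      ((w - \sum_(x in Iw_level n) mu n x *: Iw_slash (s x) v : {poly_m.+1 O})
         : {poly O})`_i.

Definition Iw_hom : set (coef_mod H -> {poly_m.+1 O}) :=
  [set phi : coef_mod H -> {poly_m.+1 O} |
    (forall c x y, phi (c *: x + y) = c *: phi x + phi y) /\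
    forall (x : H) (mu : Lambda), supported Iw_level mu ->
      Iw_integral (phi x) mu (phi ((mu : Lambda^c) *: x))].
End Iwahori.

Definition d_Iw (k : nat) (psi : 'F_p -> 'F_p -> O) : nat :=
  rank (@Iw_hom psi (k - 2)).
End Module.
End Setting.

Section GaloisSide.
Variables (p : nat) (pp : prime p) (L : closedFieldType).
Variables (iota : {rmorphism padic_num pp -> L}) (F : fieldType).
Implicit Types s t : L -> L.

(* (L, iota) is an algebraic closure of Q_p.                                   *)
Definition algebraic_closure := forall x, algebraicOver iota x.

(* The elements of the absolute Galois group, as functions.                    *)
Definition is_gal s :=
  [/\ zmod_morphism s, monoid_morphism s, bijective s &
      forall x, s (iota x) = iota x].

(* Continuity for the Krull topology, for maps to a discrete set.              *)
Definition gal_continuous (T : Type) (f : (L -> L) -> T) :=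
  forall s, is_gal s -> exists xs : seq L, forall t, is_gal t ->
    (forall x, x \in xs -> t x = s x) -> f t = f s.

(* The mod p cyclotomic character, with values in a field of characteristic p. *)
Definition cyclotomic s : F :=
  (xget 0%N [set a : nat |
     (a < p)%N /\ forall z : L, z ^+ p = 1 -> s z = z ^+ a])%:R.

(* Continuous 1-cocycles with values in F(omega), and coboundaries.            *)
Definition cocycle (c : (L -> L) -> F) :=
  gal_continuous c /\
  forall s t, is_gal s -> is_gal t -> c (s \o t) = c s + cyclotomic s * c t.

Definition coboundary (c : (L -> L) -> F) :=
  exists b : F, forall s, is_gal s -> c s = cyclotomic s * b - b.

(* The class ord_p in H^1(Q_p, F) = Hom(G, F): trivial on inertia, and 1 on    *)
(* Frobenius elements; Q_p^nr is generated by the roots of unity of order      *)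
(* prime to p. (The sign choice for Frobenius in local class field theory is   *)
(* irrelevant below.)                                                          *)
Definition unramified_ord (u : (L -> L) -> F) :=
  [/\ gal_continuous u,
      forall s t, is_gal s -> is_gal t -> u (s \o t) = u s + u t,
      forall s, is_gal s ->
        (forall n z, coprime p n -> z ^+ n = 1 -> s z = z) -> u s = 0 &
      forall s, is_gal s ->
        (forall n z, coprime p n -> z ^+ n = 1 -> s z = z ^+ p) -> u s = 1].

(* The cup product of c and u vanishes in H^2(Q_p, F(omega)). As the local     *)
(* Tate pairing is the cup product followed by the invariant isomorphism       *)
(* H^2(Q_p, F(omega)) = F, this says <c, u> = 0.                               *)
Definition tate_pairing_zero (c u : (L -> L) -> F) :=
  exists b : (L -> L) -> F, gal_continuous b /\
    forall s t, is_gal s -> is_gal t ->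
      c s * u t = cyclotomic s * b t - b (s \o t) + b s.

Definition tres_ramifiee (c : (L -> L) -> F) :=
  exists2 u, unramified_ord u & ~ tate_pairing_zero c u.

Definition tres_ramifiee_rep (rho : (L -> L) -> 'M[F]_2) :=
  [/\ gal_continuous rho,
      forall s t, is_gal s -> is_gal t -> rho (s \o t) = rho s *m rho t &
      exists (B : 'M[F]_2) (c : (L -> L) -> F),
        [/\ B \in unitmx,
            forall s, is_gal s ->
              rho s = B *m mx2 (cyclotomic s) (c s) 0 1 *m invmx B,
            cocycle c, ~ coboundary c & tres_ramifiee c]].
End GaloisSide.

(* Main.v *)
(* The vector [e] is a basis of [H] over O[[I_1]] fixed by the torus, and
   Iw = I_1 . Delta^2, so phi |-> phi(e) identifies the Iw-equivariant maps with the
   polynomials of degree at most m = k - 2 fixed by the torus: the inverse sends v to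
   the map e mu |-> int v|_g dmu(g), a limit of Riemann sums. On z^i the torus acts
   through omega^(i-s) x omega^(s-i), hence the fixed polynomials are those supported on
   exponents i = s mod p - 1, and counting these gives the rank. The completeness of O
   that makes the Riemann sums converge is inherited from that of [H]: for a Cauchy
   sequence (u_n) in O the vectors u_n e converge, and the total mass of the
   O[[I_1]]-coordinate of the limit is the limit of (u_n). *)
Require Import Defs.
From HB Require Import structures.
From mathcomp Require Import all_boot all_order all_fingroup all_algebra all_field.
From mathcomp Require Import boolp classical_sets functions.
From mathcomp Require Import cyclic ring.

Import Order.TTheory GRing.Theory Num.Theory.
Local Open Scope ring_scope.

Set Implicit Arguments.
Unset Strict Implicit.
Unset Printing Implicit Defensive.

(** * Congruences and p-adic integers *)

(** Equivariance is required for every measure supported on Iw, not only for group elements, while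
    coordinates of vectors are measures on I_1. If [mu] is the coordinate of a vector and [nu] a
    measure on Iw, the product [mu * nu] lives on Iw only and must be folded back to I_1. On each
    coset the torus part is moved to the left, where it disappears because it fixes both [e] and
    [v]. Limits are handled by congruences alone: an integral is an element congruent to the Riemann
    sum of level [n] modulo p^(n+1), for all [n]. The exponent is n+1 because level [n] of the tower
    is GL_2(Z/p^(n+1)). Existence of integrals needs O complete and their uniqueness needs O
    separated; [integers E] is defined by integrality alone, so neither property is built into
    it. *)

Section Divides.
Variable R : comNzRingType.
Implicit Types d x y z t : R.

Lemma divides0 d : divides d 0.
Proof. by exists 0; rewrite mulr0. Qed.

Lemma dividesD d x y : divides d x -> divides d y -> divides d (x + y).
Proof. by move=> [u ->] [v ->]; exists (u + v); rewrite mulrDr. Qed.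

Lemma dividesN d x : divides d x -> divides d (- x).
Proof. by move=> [u ->]; exists (- u); rewrite mulrN. Qed.

Lemma divides_mull d x y : divides d y -> divides d (x * y).
Proof. by move=> [u ->]; exists (x * u); rewrite mulrCA. Qed.

Lemma divides_mulr d x y : divides d x -> divides d (x * y).
Proof. by rewrite mulrC; apply: divides_mull. Qed.

Lemma divides_sum (I : finType) (P : pred I) d (f : I -> R) :
  (forall i, P i -> divides d (f i)) -> divides d (\sum_(i | P i) f i).
Proof.
move=> df; elim/big_ind: _ => //; first exact: divides0.
by move=> x y; apply: dividesD.
Qed.

Lemma divides_rmorph (S : comNzRingType) (f : {rmorphism R -> S}) d x :
  divides d x -> divides (f d) (f x).
Proof. by move=> [u ->]; exists (f u); rewrite rmorphM. Qed.

Lemma divides_exp d m n x : (m <= n)%N -> divides (d ^+ n) x -> divides (d ^+ m) x.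
Proof.
by move=> /subnK <- [u ->]; exists (d ^+ (n - m) * u); rewrite exprD mulrCA mulrA.
Qed.

Definition eqmod d x y := divides d (x - y).

Lemma eqmod_refl d x : eqmod d x x.
Proof. by rewrite /eqmod subrr; apply: divides0. Qed.

Lemma eqmod_sym d x y : eqmod d x y -> eqmod d y x.
Proof. by move/dividesN; rewrite opprB. Qed.

Lemma eqmod_trans d y x z : eqmod d x y -> eqmod d y z -> eqmod d x z.
Proof. by move=> dxy /(dividesD dxy); rewrite addrA subrK. Qed.

Lemma eqmodD d x x' y y' : eqmod d x x' -> eqmod d y y' -> eqmod d (x + y) (x' + y').
Proof. by move=> dx dy; rewrite /eqmod opprD addrACA; apply: dividesD. Qed.

Lemma eqmodM d x x' y y' : eqmod d x x' -> eqmod d y y' -> eqmod d (x * y) (x' * y').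
Proof.
move=> dx dy; rewrite /eqmod; have -> : x * y - x' * y' = (x - x') * y + x' * (y - y').
  by rewrite mulrBl mulrBr addrA subrK.
by apply: dividesD; [apply: divides_mulr | apply: divides_mull].
Qed.

Lemma eqmodX d x x' n : eqmod d x x' -> eqmod d (x ^+ n) (x' ^+ n).
Proof.
move=> dx; elim: n => [|n IHn]; first exact: eqmod_refl.
by rewrite !exprS; apply: eqmodM.
Qed.

Lemma eqmod_sum (I : finType) (P : pred I) d (f g : I -> R) :
  (forall i, P i -> eqmod d (f i) (g i)) ->
  eqmod d (\sum_(i | P i) f i) (\sum_(i | P i) g i).
Proof. by move=> dfg; rewrite /eqmod -sumrB; apply: divides_sum. Qed.
End Divides.

Section Padic.
Context {p : nat} {pp : prime p}.
Local Notation Zp := (padic_int pp).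
Implicit Types x y z : Zp.

Lemma padic_res_ge0 x n : 0 <= padic_res x n.
Proof. by rewrite -padic_mod modz_ge0 // expf_neq0 // -lt0n prime_gt0. Qed.

Lemma padic_res_lt x n : padic_res x n < p%:Z ^+ n.
Proof. by rewrite -padic_mod ltz_pmod // exprn_gt0 // ltz_nat prime_gt0. Qed.

Lemma padic_res_nat (a n : nat) : padic_res (a%:R : Zp) n = (a%:Z %% p%:Z ^+ n)%Z.
Proof.
elim: a => [|a IHa]; first by rewrite mulr0n.
by rewrite -natr1 -[_ + 1]/(padic_add _ _) /= IHa modzDm -PoszD addn1.
Qed.

(** Dividing by p^k costs k digits: component [n] of the quotient is read off from component [k + n]
    of [x]. *)
Lemma padic_divides x k : padic_res x k = 0 -> divides (p%:R ^+ k) x.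
Proof.
move=> x0; have pn0 n : p%:Z ^+ n != 0 by rewrite expf_neq0 // -lt0n prime_gt0.
have dvd n : (p%:Z ^+ k %| padic_res x (k + n))%Z.
  by apply/dvdz_mod0P; rewrite -(padic_le x (leq_addr n k)) x0 mod0z.
pose f n := (padic_res x (k + n) %/ p%:Z ^+ k)%Z.
have fK n : f n * p%:Z ^+ k = padic_res x (k + n) by rewrite divzK.
have fP n : (f n = f n.+1 %[mod p%:Z ^+ n])%Z.
  apply/eqP; rewrite eqz_mod_dvd -(@dvdz_mul2r (p%:Z ^+ k)) // mulrBl !fK -exprD.
  by rewrite -eqz_mod_dvd (addnC n k) addnS; apply/eqP/padic_compat.
exists (padic_of pp fP); apply: padic_inj => n; rewrite -natrX.
rewrite -[_ * _]/(padic_mul _ _) /= padic_res_nat modzMml modzMmr.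
rewrite mulrC -natz natrX natz fK -(padic_le x (leq_addl k n)).
by rewrite padic_mod.
Qed.

Lemma modp_redE x : modp_red x = (`|padic_res x 1|%N)%:R :> 'F_p.
Proof. by rewrite /modp_red /padic_red pmulrn gez0_abs ?padic_res_ge0. Qed.

Lemma level_redE n x : level_red n x = (`|padic_res x n.+1|%N)%:R.
Proof. by rewrite /level_red /padic_red pmulrn gez0_abs ?padic_res_ge0. Qed.

Lemma level_red_eq n x y : level_red n x = level_red n y -> eqmod (p%:R ^+ n.+1) x y.
Proof.
move/eqP; rewrite -subr_eq0 -rmorphB /eqmod; move: (x - y) => z {x y} /eqP z0.
apply: padic_divides; move: z0 => /(congr1 val); rewrite [X in val X]level_redE.
rewrite /= val_Zp_nat ?level_gt1 // modn_small.
  by move/eqP; rewrite absz_eq0 => /eqP.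
rewrite -ltz_nat gez0_abs ?padic_res_ge0 // -[Posz (p ^ _)]natz natrX natz.
exact: padic_res_lt.
Qed.

Lemma level_red_modp n x : ((level_red n x : nat) = modp_red x %[mod p])%N.
Proof.
rewrite level_redE modp_redE val_Zp_nat ?level_gt1 // val_Fp_nat // modn_mod.
rewrite modn_dvdm ?expnS ?dvdn_mulr //; apply/eqP; rewrite -eqz_nat -!modz_nat.
by rewrite !gez0_abs ?padic_res_ge0 // -(expr1 p%:Z) -padic_le.
Qed.

Lemma modp_red_eqmod n x y : eqmod (p%:R ^+ n.+1) x y -> modp_red x = modp_red y.
Proof.
case=> z /(congr1 (@modp_red p pp)); rewrite rmorphB rmorphM rmorphXn rmorph_nat.
by rewrite (pchar_Fp_0 pp) expr0n mul0r => /eqP; rewrite subr_eq0 => /eqP.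
Qed.

(** Component [n] is coprime to p^n, so Bezout inverts it; the inverses are compatible because an
    inverse modulo p^n is unique. *)
Lemma modp_red_unit x : modp_red x != 0 -> x \is a GRing.unit.
Proof.
move=> x0.
have cop n : coprimez (padic_res x n) (p%:Z ^+ n).
  case: n => [|n]; first by rewrite expr0 coprimezE coprimen1.
  rewrite coprimezXr // coprimezE coprime_sym prime_coprime //=.
  apply: contra x0 => /dvdnP[q xq]; rewrite modp_redE.
  suff -> : padic_res x 1 = 0 by [].
  rewrite -padic_mod (padic_le x (ltn0Sn n)) expr1; apply/dvdz_mod0P.
  by rewrite dvdzE xq /= dvdn_mull.
have /choice[y yP] n : exists u, (u * padic_res x n = 1 %[mod p%:Z ^+ n])%Z.
  have /coprimezP[[u v] /= uv] := cop n; exists u.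
  by rewrite -uv addrC modzMDl.
have yc n : (y n = y n.+1 %[mod p%:Z ^+ n])%Z.
  apply/eqP; rewrite eqz_mod_dvd -(@Gauss_dvdzl _ _ (padic_res x n)); last first.
    by rewrite coprimez_sym.
  rewrite mulrBl -eqz_mod_dvd yP -modzMmr padic_compat modzMmr.
  have /eqP := yP n.+1; rewrite eqz_mod_dvd => yn.
  rewrite eq_sym eqz_mod_dvd; apply: dvdz_trans yn.
  by rewrite exprS dvdz_mull.
have yx : padic_of pp yc * x = 1.
  by apply: padic_inj => n; rewrite -[_ * _]/(padic_mul _ _) /= modzMml yP.
by apply/unitrPr; exists (padic_of pp yc); rewrite mulrC.
Qed.

(** The lift is the limit of the a^(p^n): Euler's theorem modulo p^(n+1) shows both that these
    powers are compatible and that the limit is a (p-1)-th root of unity. *)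
Lemma teichmuller_exists (a : 'F_p) : a != 0 ->
  exists x : Zp, x ^+ p.-1 = 1 /\ modp_red x = a.
Proof.
move=> a0; pose f n := ((a : nat) ^ (p ^ n))%:Z.
have cop : coprime a p.
  rewrite coprime_sym prime_coprime //; apply: contra a0 => /dvdnP[q aq].
  by rewrite -[a]natr_Zp aq natrM (pchar_Fp_0 pp) mulr0.
have eul n : ((a : nat) ^ (p ^ n * p.-1) = 1 %[mod p ^ n.+1])%N.
  have := @Euler_exp_totient a (p ^ n.+1); rewrite totient_pfactor // mulnC; apply.
  exact: coprimeXr.
have fS n : ((a : nat) ^ (p ^ n.+1) = (a : nat) ^ (p ^ n) %[mod p ^ n.+1])%N.
  have -> : ((a : nat) ^ (p ^ n.+1) = a ^ (p ^ n) * a ^ (p ^ n * p.-1))%N.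
    by rewrite -expnD -mulnS prednK ?prime_gt0 // expnSr.
  by rewrite -modnMmr eul modnMmr muln1.
have fP n : (f n = f n.+1 %[mod p%:Z ^+ n])%Z.
  rewrite /f -[p%:Z]natz -natrX natz !modz_nat; congr Posz.
  by rewrite -(@modn_dvdm (p ^ n.+1)) ?dvdn_exp2l // -fS modn_dvdm ?dvdn_exp2l.
exists (padic_of pp fP); split.
  apply: padic_inj => n; apply/eqP.
  have resX (x : Zp) j : padic_res (x ^+ j) n = (padic_res x n ^+ j %% p%:Z ^+ n)%Z.
    elim: j => [|j IHj]; first by rewrite !expr0.
    by rewrite !exprS -[_ * _]/(padic_mul _ _) /= IHj modzMmr.
  rewrite resX /= modzXm /f -[p%:Z]natz -natrX natz -[Posz (a ^ _)]natz -natrX natz.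
  rewrite -expnM !modz_nat eqz_nat /=.
  rewrite -(@modn_dvdm (p ^ n.+1)) ?dvdn_exp2l // eul modn_dvdm ?dvdn_exp2l //.
apply: val_inj; rewrite modp_redE /= expr1 modz_nat absz_nat val_Fp_nat // modn_mod.
have := fS 0%N; rewrite !expn1 => ->.
by rewrite modn_small // -[X in (_ < X)%N](Fp_cast pp).
Qed.

Lemma teichmullerP (a : 'F_p) : a != 0 ->
  teichmuller pp a ^+ p.-1 = 1 /\ modp_red (teichmuller pp a) = a.
Proof. by move=> /teichmuller_exists ex; apply: (xgetPex 0 ex). Qed.

(* The cofactor of [x - y] in [x ^+ p.-1 - y ^+ p.-1] is a unit: it reduces to
   [p.-1 * a ^+ (p - 2)]. *)
Lemma root1_modp_inj x y : x ^+ p.-1 = 1 -> y ^+ p.-1 = 1 ->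
  modp_red x = modp_red y -> x = y.
Proof.
move=> x1 y1 xy; apply/eqP; rewrite -subr_eq0.
have := subrXX x y p.-1; rewrite x1 y1 subrr => /esym/eqP; rewrite mulf_eq0 => /orP[//|].
move/eqP/(congr1 (@modp_red p pp)); rewrite rmorph0 rmorph_sum /=.
under eq_bigr => i _.
  rewrite rmorphM !rmorphXn /= xy -exprD.
  have -> : (p.-1.-1 - i + i = p.-1.-1)%N by rewrite subnK // -ltnS prednK // -subn1
    subn_gt0 (prime_gt1 pp).
  over.
rewrite sumr_const card_ord => /eqP.
have y0 : modp_red y != 0.
  apply: contraTneq isT => y0; have := congr1 (@modp_red p pp) y1.
  rewrite rmorphXn rmorph1 [X in X ^+ _]y0 expr0n eqn0Ngt -subn1 subn_gt0 (prime_gt1 pp).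
  by move/esym/eqP; rewrite oner_eq0.
rewrite -mulr_natr mulf_eq0 expf_eq0 (negPf y0) andbF /= -subn1 natrB ?prime_gt0 //.
by rewrite (pchar_Fp_0 pp) sub0r oppr_eq0 oner_eq0.
Qed.

Lemma teichmullerM (a b : 'F_p) : a != 0 -> b != 0 ->
  teichmuller pp (a * b) = teichmuller pp a * teichmuller pp b.
Proof.
move=> a0 b0; have [a1 aE] := teichmullerP a0; have [b1 bE] := teichmullerP b0.
have [c1 cE] := teichmullerP (mulf_neq0 a0 b0).
by apply: root1_modp_inj; rewrite ?exprMn ?a1 ?b1 ?mul1r // rmorphM /= cE aE bE.
Qed.

Lemma teichmuller1 : teichmuller pp 1 = 1.
Proof.
have [c1 cE] := teichmullerP (oner_neq0 'F_p).
by apply: root1_modp_inj; rewrite ?expr1n // cE rmorph1.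
Qed.

Lemma teichmuller_unit (a : 'F_p) : a != 0 -> teichmuller pp a \is a GRing.unit.
Proof. by move=> a0; apply: modp_red_unit; rewrite (teichmullerP a0).2. Qed.
End Padic.

(** * The action on polynomials *)

Section Slash.
Context {R : comNzRingType}.
Implicit Types (P U V : {poly R}) (a b : R).

(** The degree [m] homogenization of [P] at the pair (U, V). The slash by [g] takes for U and V the
    rows of [g], read as linear forms, which avoids the denominators of the fractional linear
    formula. *)
Definition hev m P U V := \sum_(i < m.+1) P`_i *: (U ^+ i * V ^+ (m - i)).

Lemma hevD m P Q U V : hev m (P + Q) U V = hev m P U V + hev m Q U V.
Proof. by rewrite -big_split; apply: eq_bigr => i _; rewrite coefD scalerDl. Qed.

Lemma hevZ m a P U V : hev m (a *: P) U V = a *: hev m P U V.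
Proof. by rewrite scaler_sumr; apply: eq_bigr => i _; rewrite coefZ scalerA. Qed.

Lemma hev_sum m n (P : 'I_n -> {poly R}) U V :
  hev m (\sum_i P i) U V = \sum_i hev m (P i) U V.
Proof.
elim/big_ind2: _ => // [|Q W Q' W' <- <-]; last by rewrite hevD.
by apply: big1 => i _; rewrite coef0 scale0r.
Qed.

(** Multiplying by a linear form raises the degree of homogenization by one; the size bound ensures
    that no coefficient of [P] is cut off. *)
Lemma hev_mul m a b P U V : (size P <= m.+1)%N ->
  hev m.+1 ((a *: 'X + b%:P) * P) U V = (a *: U + b *: V) * hev m P U V.
Proof.
move=> sP; rewrite mulrDl mul_polyC -scalerAl hevD !hevZ mulrDl -!scalerAl.
congr (_ *: _ + _ *: _).
  rewrite /hev big_ord_recl coefXM eqxx scale0r add0r big_distrr; apply: eq_bigr => i _.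
  by rewrite /= coefXM /= subSS exprS -mulrA -scalerAr.
rewrite /hev big_ord_recr /= nth_default // scale0r addr0 big_distrr.
apply: eq_bigr => i _ /=; rewrite subSn -1?ltnS // exprS -scalerAr.
by congr (_ *: _); rewrite mulrCA.
Qed.

Lemma size_lin_exp a b i : (size ((a *: 'X + b%:P) ^+ i) <= i.+1)%N.
Proof.
apply: leq_trans (size_poly_exp_leq _ _) _; rewrite ltnS -[leqRHS]mul1n leq_mul2r.
apply/orP; right; rewrite -subn1 leq_subLR; apply: leq_trans (size_polyD _ _) _.
rewrite geq_max (leq_trans (size_scale_leq _ _)) ?size_polyX //=.
by rewrite (leq_trans (size_polyC_leq1 _)).
Qed.

Lemma size_lin_prod a b c d i j :
  (size ((a *: 'X + b%:P) ^+ i * (c *: 'X + d%:P) ^+ j)%R <= (i + j).+1)%N.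
Proof.
have A := size_lin_exp a b i; have B := size_lin_exp c d j.
apply: leq_trans (size_polyMleq _ _) _; have := leq_add A B.
by rewrite addSn addnS; case: (_ + _)%N.
Qed.

Lemma hev_prod a b c d i j U V :
  hev (i + j) ((a *: 'X + b%:P) ^+ i * (c *: 'X + d%:P) ^+ j) U V =
    (a *: U + b *: V) ^+ i * (c *: U + d *: V) ^+ j.
Proof.
elim: i => [|i IHi]; last first.
  by rewrite addSn !exprS -mulrA hev_mul ?size_lin_prod // IHi mulrA.
rewrite !expr0 !mul1r add0n; elim: j => [|j IHj].
  by rewrite !expr0 /hev big_ord1 coef1 eqxx scale1r !expr0 mulr1.
by rewrite exprS hev_mul ?size_lin_exp // IHj exprS.
Qed.

Context {m : nat}.
Implicit Types (g h : 'M[R]_2) (v : {poly_m.+1 R}).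

Lemma slashE g v : slash g v = hev m v (g 0 0 *: 'X + (g 0 1)%:P)
  (g 1 0 *: 'X + (g 1 1)%:P) :> {poly R}.
Proof.
rewrite /slash -/(hev m v _ _) npolypK //; apply: leq_trans (size_sum _ _ _) _.
apply/bigmax_leqP => i _; apply: leq_trans (size_scale_leq _ _) _.
by apply: leq_trans (size_lin_prod _ _ _ _ _ _) _; rewrite subnKC // -ltnS.
Qed.

(** Under [g] the monomial of index [i] becomes a product of [m] linear forms, and [hev_prod]
    substitutes into such a product factor by factor; the resulting forms are the rows of
    [g *m h]. *)
Lemma slashM g h v : slash (g *m h) v = slash h (slash g v).
Proof.
apply: val_inj; rewrite [LHS]slashE [RHS]slashE slashE {3}/hev hev_sum [LHS]/hev.
apply: eq_bigr => i _; rewrite hevZ; congr (_ *: _).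
have im : (i + (m - i) = m)%N by rewrite subnKC // -ltnS.
rewrite -[X in hev X]im hev_prod.
have ent (k : 'I_2) : (g *m h) k 0 *: 'X + ((g *m h) k 1)%:P =
    g k 0 *: (h 0 0 *: 'X + (h 0 1)%:P) + g k 1 *: (h 1 0 *: 'X + (h 1 1)%:P).
  rewrite !mxE !big_ord_recl !big_ord0 !addr0 /=.
  have -> : lift ord0 ord0 = 1 :> 'I_2 by apply: val_inj.
  rewrite !scalerDr !scalerDl !scalerA polyCD !polyCM -!mul_polyC !polyCM.
  by rewrite addrACA.
by rewrite !ent.
Qed.

Lemma slashD g : {morph @slash R m g : u v / u + v}.
Proof. by move=> u v; apply: val_inj; rewrite [LHS]slashE hevD -!slashE. Qed.

Lemma slashZ g a : {morph @slash R m g : v / a *: v}.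
Proof. by move=> v; apply: val_inj; rewrite [LHS]slashE hevZ -!slashE. Qed.

Lemma coef_slash_diag g v i : g 0 1 = 0 -> g 1 0 = 0 -> (i <= m)%N ->
  (slash g v : {poly R})`_i = g 0 0 ^+ i * g 1 1 ^+ (m - i) * (v : {poly R})`_i.
Proof.
move=> g01 g10 lim; rewrite slashE /hev g01 g10 scale0r addr0 add0r coef_sum.
have co (j : nat) : ((v : {poly R})`_j *: ((g 0 0 *: 'X) ^+ j * (g 1 1)%:P ^+ (m - j)))`_i
    = (v : {poly R})`_j * (g 0 0 ^+ j * g 1 1 ^+ (m - j)) * (i == j)%:R.
  by rewrite exprZn -polyC_exp mulrC mul_polyC !coefZ coefXn; ring.
have i_lt : (i < m.+1)%N by [].
rewrite (bigD1 (Ordinal i_lt)) //= co eqxx mulr1 big1 ?addr0 1?mulrC // => j ji.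
rewrite co; case: eqP => [ij|]; last by rewrite mulr0.
by case/eqP: ji; apply: val_inj.
Qed.
End Slash.

(** * Finite levels of GL_2(Z_p) *)

Section Reduction.
Context {p : nat} {pp : prime p}.
Local Notation Zp := (padic_int pp).
Local Notation K := (K_tower pp).
Implicit Types g h : 'M[Zp]_2.

Lemma GL_redE (R : finComUnitRingType) (f : {rmorphism Zp -> R}) g :
  g \in unitmx -> GLval (GL_red f g) = map_mx f g.
Proof.
move=> ug; rewrite /GL_red ug -[GLval _]/(val _) val_insubd.
by have -> : map_mx f g \is a GRing.unit by apply: (rmorph_unit (map_mx f)).
Qed.

Lemma GL_red1 (R : finComUnitRingType) (f : {rmorphism Zp -> R}) : GL_red f 1%:M = 1%g.
Proof. by apply: val_inj; rewrite [LHS]GL_redE ?unitmx1 // map_mx1. Qed.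

Lemma GL_redM (R : finComUnitRingType) (f : {rmorphism Zp -> R}) g h :
  g \in unitmx -> h \in unitmx -> GL_red f (g *m h) = (GL_red f g * GL_red f h)%g.
Proof.
move=> ug uh; apply: val_inj.
have -> : val (GL_red f g * GL_red f h)%g = GLval (GL_red f g) *m GLval (GL_red f h) by [].
by rewrite [LHS]GL_redE ?unitmx_mul ?ug // !GL_redE // map_mxM.
Qed.

Lemma val_modp_red n (x : Zp) : modp_red x = ((level_red n x : nat) %% p)%N :> nat.
Proof.
rewrite level_red_modp modn_small // -[X in (_ < X)%N](Fp_cast pp); exact: ltn_ord.
Qed.

Lemma modp_red_eq0 n (x : Zp) : (modp_red x == 0) = (p %| (level_red n x : nat))%N.
Proof. by rewrite -val_eqE /= (val_modp_red n). Qed.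

Lemma modp_red_eq1 n (x : Zp) : (modp_red x == 1) = ((level_red n x : nat) == 1 %[mod p])%N.
Proof.
rewrite -val_eqE /= (val_modp_red n).
by rewrite (modn_small (prime_gt1 pp)).
Qed.

Lemma modp_red_neq0 (x : Zp) : x \is a GRing.unit -> modp_red x != 0.
Proof. by move=> ux; rewrite -unitfE; apply: rmorph_unit. Qed.

(** A section of the reduction map. It need not be multiplicative: [sec (x * y)] and
    [sec x *m sec y] are only known to agree modulo p^(n+1). *)
Definition sec n (x : K n) : 'M[Zp]_2 :=
  \matrix_(i, j) (GLval x i j : nat)%:R.

Lemma level_red_sec n (x : K n) i j : level_red n (sec x i j) = GLval x i j.
Proof. by rewrite mxE rmorph_nat natr_Zp. Qed.

Lemma map_sec n (x : K n) : map_mx (level_red n) (sec x) = GLval x.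
Proof. by apply/matrixP => i j; rewrite mxE level_red_sec. Qed.

Lemma sec_unit n (x : K n) : sec x \in unitmx.
Proof.
apply: modp_red_unit; rewrite (modp_red_eq0 n) -det_map_mx /= map_sec.
have : \det (GLval x) \is a GRing.unit by exact: (valP x).
rewrite -[\det _ in X in X -> _]natr_Zp unitZpE ?level_gt1 //.
by rewrite coprime_pexpl // prime_coprime.
Qed.

Lemma GL_red_sec n (x : K n) : GL_red (@level_red p pp n) (sec x) = x.
Proof. by apply: val_inj; rewrite [LHS]GL_redE ?sec_unit // map_sec. Qed.

Lemma GL_red_eqmod n g h : g \in unitmx -> h \in unitmx ->
  GL_red (@level_red p pp n) g = GL_red (@level_red p pp n) h ->
  forall i j, eqmod (p%:R ^+ n.+1) (g i j) (h i j).
Proof.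
move=> ug uh /(congr1 (fun x => GLval x)); rewrite !GL_redE // => gh i j.
by apply: level_red_eq; have := congr1 (fun M : 'M_2 => M i j) gh; rewrite !mxE.
Qed.

Lemma mem_Iw_level n (x : K n) g :
  g \in unitmx -> GL_red (@level_red p pp n) g = x ->
  (x \in Iw_level pp n) = (modp_red (g 1 0) == 0).
Proof. by move=> ug <-; rewrite inE GL_redE // mxE (modp_red_eq0 n). Qed.

Lemma mem_I1_level n (x : K n) g :
  g \in unitmx -> GL_red (@level_red p pp n) g = x ->
  (x \in I1_level pp n) =
    [&& modp_red (g 1 0) == 0, modp_red (g 0 0) == 1 & modp_red (g 1 1) == 1].
Proof.
by move=> ug <-; rewrite inE GL_redE // !mxE (modp_red_eq0 n) !(modp_red_eq1 n).
Qed.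

Lemma Iw_sec n (x : K n) : x \in Iw_level pp n -> Iw (sec x).
Proof.
move=> xI; split; first exact: sec_unit.
by apply/eqP; rewrite -(mem_Iw_level (sec_unit x) (GL_red_sec x)).
Qed.

Lemma trans_GL_red n g :
  @trans K n (GL_red (@level_red p pp n.+1) g) = GL_red (@level_red p pp n) g.
Proof. exact: K_pt_compat. Qed.

Lemma trans_sec n (x : K n.+1) : GL_red (@level_red p pp n) (sec x) = trans x.
Proof. by rewrite -trans_GL_red GL_red_sec. Qed.

(** Reduction to GL_2(F_p), level 0 of the tower. It decides membership in [Iw_level] and
    [I1_level], and its fibres are the pieces into which measures are cut below. *)
Fixpoint proj0 n : K n -> K 0 :=
  if n is m.+1 return K n -> K 0 then fun x => proj0 (trans x) else id.

Lemma proj0S n (x : K n.+1) : proj0 x = proj0 (trans x).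
Proof. by []. Qed.

Lemma proj0_GL_red n g : proj0 (GL_red (@level_red p pp n) g) = GL_red (@level_red p pp 0) g.
Proof. by elim: n => // n IHn; rewrite proj0S trans_GL_red. Qed.

Lemma proj0M n : {morph @proj0 n : x y / (x * y)%g}.
Proof. by elim: n => // n IHn x y; rewrite !proj0S transM IHn. Qed.

Lemma trans_Iw n (x : K n.+1) : (trans x \in Iw_level pp n) = (x \in Iw_level pp n.+1).
Proof.
rewrite (mem_Iw_level (sec_unit x) (trans_sec x)).
by rewrite (mem_Iw_level (sec_unit x) (GL_red_sec x)).
Qed.

Lemma proj0_Iw n (x : K n) : (proj0 x \in Iw_level pp 0) = (x \in Iw_level pp n).
Proof. by elim: n x => // n IHn x; rewrite proj0S IHn trans_Iw. Qed.

Lemma trans_I1 n (x : K n.+1) : (trans x \in I1_level pp n) = (x \in I1_level pp n.+1).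
Proof.
rewrite (mem_I1_level (sec_unit x) (trans_sec x)).
by rewrite (mem_I1_level (sec_unit x) (GL_red_sec x)).
Qed.

Lemma proj0_I1 n (x : K n) : (proj0 x \in I1_level pp 0) = (x \in I1_level pp n).
Proof. by elim: n x => // n IHn x; rewrite proj0S IHn trans_I1. Qed.

Lemma I1_sub_Iw n (x : K n) : x \in I1_level pp n -> x \in Iw_level pp n.
Proof. by rewrite !inE => /and3P[]. Qed.

Lemma det2 (R : comNzRingType) (g : 'M[R]_2) : \det g = g 0 0 * g 1 1 - g 0 1 * g 1 0.
Proof.
rewrite (expand_det_row _ 0) !big_ord_recl big_ord0 addr0 /cofactor !det_mx11 !mxE /=.
rewrite expr0 mul1r expr1 mulN1r mulrN.
by congr (_ * g _ _ - g _ _ * g _ _); apply: val_inj.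
Qed.

Lemma mul_mx2E (R : comNzRingType) (g h : 'M[R]_2) i j :
  (g *m h) i j = g i 0 * h 0 j + g i 1 * h 1 j.
Proof.
rewrite !mxE !big_ord_recl big_ord0 addr0.
by congr (_ + g _ _ * h _ _); apply: val_inj.
Qed.

Lemma Iw_diag g : Iw g -> modp_red (g 0 0) != 0 /\ modp_red (g 1 1) != 0.
Proof.
case=> ug g10; have := modp_red_neq0 ug.
rewrite det2 rmorphB !rmorphM /= g10 mulr0 subr0 mulf_eq0 negb_or.
by move/andP.
Qed.

Lemma Iw_mul g h : Iw g -> Iw h -> Iw (g *m h).
Proof.
move=> [ug g0] [uh h0]; split; first by rewrite unitmx_mul ug.
by rewrite mul_mx2E rmorphD !rmorphM /= g0 h0 mul0r mulr0 addr0.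
Qed.

Lemma Iw_levelM n (x y : K n) :
  x \in Iw_level pp n -> y \in Iw_level pp n -> (x * y)%g \in Iw_level pp n.
Proof.
move=> /Iw_sec Ix /Iw_sec Iy; have [u m0] := Iw_mul Ix Iy.
rewrite (mem_Iw_level u) ?m0 //.
by rewrite GL_redM ?GL_red_sec //; apply: sec_unit.
Qed.

Lemma I1_levelM n (x y : K n) :
  x \in I1_level pp n -> y \in I1_level pp n -> (x * y)%g \in I1_level pp n.
Proof.
have ux := sec_unit x; have uy := sec_unit y.
rewrite (mem_I1_level ux (GL_red_sec x)) (mem_I1_level uy (GL_red_sec y)).
rewrite (@mem_I1_level _ _ (sec x *m sec y)) ?unitmx_mul ?ux //; last first.
  by rewrite GL_redM ?GL_red_sec.
move=> /and3P[/eqP x0 /eqP x1 /eqP x2] /and3P[/eqP y0 /eqP y1 /eqP y2].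
rewrite !mul_mx2E !rmorphD !rmorphM /= x0 x1 x2 y0 y1 y2.
by rewrite !(mul0r, mulr0, mulr1, addr0, add0r) !eqxx.
Qed.
End Reduction.

Arguments sec {p pp n} x.

(** * Integration against measures on the Iwahori subgroup *)

Section VectorPairing.
Context {A : comNzRingType} {M : lmodType A}.

Definition vpair {gT : finType} (a : {ffun gT -> A}) (phi : gT -> M) : M :=
  \sum_x a x *: phi x.

Lemma vpair_push (gT hT : finGroupType) (f : gT -> hT) a phi :
  vpair (galg_push f a) phi = vpair a (phi \o f).
Proof.
rewrite /vpair [RHS](partition_big f xpredT) //=; apply: eq_bigr => x _.
by rewrite ffunE scaler_suml; apply: eq_bigr => y /eqP ->.
Qed.

(** The factor [b], which acts last, is integrated on the outside: this is the order that a right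
    action requires in [Iw_integral_mul]. *)
Lemma vpair_mulC (gT : finGroupType) (a b : {ffun gT -> A}) phi :
  vpair (galg_mul a b) phi = vpair b (fun z => vpair a (fun y => phi (y * z)%g)).
Proof.
rewrite /vpair; under eq_bigr do rewrite ffunE scaler_suml.
rewrite exchange_big; under [RHS]eq_bigr do rewrite scaler_sumr.
rewrite [RHS]exchange_big; apply: eq_bigr => y _ /=.
rewrite [RHS](partition_big (fun z => y * z)%g xpredT) //=; apply: eq_bigr => x _.
by rewrite scaler_suml; apply: eq_bigr => z /eqP ->; rewrite scalerA mulrC.
Qed.

Lemma vpair_pt (gT : finGroupType) (g : gT) phi : vpair (galg_pt A g) phi = phi g.
Proof.
rewrite /vpair (bigD1 g) //= ffunE eqxx scale1r big1 ?addr0 //.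
by move=> x /negPf xg; rewrite ffunE xg scale0r.
Qed.
End VectorPairing.

Lemma iwasawa_linE (A : comNzRingType) (T : tower) (c : A) (mu nu : iwasawa A T) n x :
  (c *: mu + nu) n x = c * mu n x + nu n x.
Proof. by rewrite /= !ffunE. Qed.

Section PolyCongruence.
Context {R : comNzRingType}.
Implicit Types (d : R) (P Q U V : {poly R}).

Lemma eqmod_coefP d P Q : eqmod d%:P P Q <-> forall i, eqmod d P`_i Q`_i.
Proof.
split=> [[T PQ] i|/choice[t PQ]].
  by exists T`_i; rewrite -coefB PQ mul_polyC coefZ.
exists (\poly_(i < maxn (size P) (size Q)) t i); apply/polyP => i.
rewrite coefB mul_polyC coefZ coef_poly; case: ltnP => [_|]; first exact: PQ.
by rewrite geq_max => /andP[sP sQ]; rewrite !nth_default // subrr mulr0.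
Qed.

Lemma eqmod_polyC d a b : eqmod d a b -> eqmod d%:P a%:P b%:P.
Proof. by rewrite /eqmod -polyCB; exact: (@divides_rmorph _ _ polyC). Qed.

Lemma eqmod_hev d m P P' U U' V V' :
  eqmod d%:P P P' -> eqmod d%:P U U' -> eqmod d%:P V V' ->
  eqmod d%:P (hev m P U V) (hev m P' U' V').
Proof.
move=> /eqmod_coefP PP UU VV; apply: eqmod_sum => i _; rewrite -!mul_polyC.
apply: eqmodM; first by apply: eqmod_polyC; apply: PP.
by apply: eqmodM; apply: eqmodX.
Qed.

Lemma eqmodZ d a P Q : eqmod d%:P P Q -> eqmod d%:P (a *: P) (a *: Q).
Proof. by move=> PQ; rewrite -!mul_polyC; apply: eqmodM => //; apply: eqmod_refl. Qed.
Lemma eqmod_slash m d (g h : 'M[R]_2) (u w : {poly_m.+1 R}) :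
  (forall i j, eqmod d (g i j) (h i j)) -> eqmod d%:P (u : {poly R}) w ->
  eqmod d%:P (slash g u : {poly R}) (slash h w).
Proof.
move=> gh uw; rewrite !slashE; apply: eqmod_hev => //.
  apply: eqmodD; last by apply: eqmod_polyC; apply: gh.
  by rewrite -!mul_polyC; apply: eqmodM; [apply: eqmod_polyC; apply: gh | exact: eqmod_refl].
apply: eqmodD; last by apply: eqmod_polyC; apply: gh.
by rewrite -!mul_polyC; apply: eqmodM; [apply: eqmod_polyC; apply: gh | exact: eqmod_refl].
Qed.
End PolyCongruence.

Section Integral.
Context {p : nat} {pp : prime p} {E : fieldExtType (padic_num pp)}.
Local Notation Zp := (padic_int pp).
Local Notation K := (K_tower pp).
Local Notation O := (integers E).
Local Notation Lambda := (iwasawa O K).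
Context {psi : 'F_p -> 'F_p -> O} {m : nat}.
Local Notation Pol := {poly_m.+1 O}.
Local Notation act := (@Iw_slash p pp E psi m).
Implicit Types (u v w : Pol) (mu nu : Lambda).

Definition neqmod n u w := eqmod (p%:R ^+ n)%:P (u : {poly O}) (w : {poly O}).

Lemma neqmod_coefP n u w :
  neqmod n u w <-> forall i, eqmod (p%:R ^+ n) (u : {poly O})`_i (w : {poly O})`_i.
Proof. exact: eqmod_coefP. Qed.

Lemma neqmod_refl n u : neqmod n u u.
Proof. exact: eqmod_refl. Qed.

Lemma neqmod_sym n u w : neqmod n u w -> neqmod n w u.
Proof. exact: eqmod_sym. Qed.

Lemma neqmod_trans n u v w : neqmod n v u -> neqmod n u w -> neqmod n v w.
Proof. exact: eqmod_trans. Qed.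

Lemma neqmodD n u u' w w' : neqmod n u u' -> neqmod n w w' -> neqmod n (u + w) (u' + w').
Proof. exact: eqmodD. Qed.

Lemma neqmodZ n a u w : neqmod n u w -> neqmod n (a *: u) (a *: w).
Proof. exact: eqmodZ. Qed.

Lemma neqmod_sum n (I : finType) (P : pred I) (f g : I -> Pol) :
  (forall x, P x -> neqmod n (f x) (g x)) ->
  neqmod n (\sum_(x | P x) f x) (\sum_(x | P x) g x).
Proof.
move=> fg; elim/big_ind2: _ => [|u u' w w'|//]; first exact: neqmod_refl.
exact: neqmodD.
Qed.

Lemma neqmod_vpair n (gT : finType) (a : {ffun gT -> O}) (f g : gT -> Pol) :
  (forall x, neqmod n (f x) (g x)) -> neqmod n (vpair a f) (vpair a g).
Proof. by move=> fg; apply: neqmod_sum => x _; apply: neqmodZ. Qed.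

Lemma neqmod_le n k u w : (n <= k)%N -> neqmod k u w -> neqmod n u w.
Proof.
move=> nk /neqmod_coefP uw; apply/neqmod_coefP => i.
exact: divides_exp nk (uw i).
Qed.

Lemma act_is_linear g c u w : act g (c *: u + w) = c *: act g u + act g w.
Proof. by rewrite /Iw_slash slashD slashZ scalerDr !scalerA mulrC. Qed.

Lemma act0 g : act g 0 = 0.
Proof. by rewrite -[in LHS](subrr 0) -scaleN1r addrC act_is_linear scaleN1r addNr. Qed.

Lemma act_vpair g (gT : finType) (a : {ffun gT -> O}) (f : gT -> Pol) :
  act g (vpair a f) = vpair a (fun x => act g (f x)).
Proof.
rewrite /vpair; elim/big_ind2: _ => [|u u' w w' <- <-|x _]; first exact: act0.
  by rewrite -{1}[u']scale1r act_is_linear scale1r.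
by rewrite -[X in act g X]addr0 act_is_linear act0 addr0.
Qed.

Lemma act_neqmod n g u w : neqmod n u w -> neqmod n (act g u) (act g w).
Proof.
move=> uw; apply: (@eqmodZ _ _ _ (slash _ u) (slash _ w)).
by apply: eqmod_slash => // i j; apply: eqmod_refl.
Qed.

(** The slash is polynomial in the entries of the matrix, and [psi] sees only residues modulo p,
    which agree because the exponent [n.+1] is positive. *)
Lemma act_congr n (g h : 'M[Zp]_2) v :
  (forall i j, eqmod (p%:R ^+ n.+1) (g i j) (h i j)) -> neqmod n.+1 (act g v) (act h v).
Proof.
move=> gh; have red i j : modp_red (g i j) = modp_red (h i j).
  exact: modp_red_eqmod (gh i j).
rewrite /neqmod /Iw_slash !det2 !rmorphB !rmorphM /= !red.
apply: (@eqmodZ _ _ _ (slash _ v) (slash _ v)).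
apply: eqmod_slash => [i j|]; last exact: eqmod_refl.
rewrite !mxE /eqmod -rmorphB.
by have := divides_rmorph (padic_integer E) (gh i j); rewrite rmorphXn rmorph_nat.
Qed.

(** Extended by zero off Iw, so that sums run over the whole finite group, where pushforward and
    convolution are computed. *)
Definition evl n v (x : K n) : Pol := if x \in Iw_level pp n then act (sec x) v else 0.

Lemma evl_in n v (x : K n) : x \in Iw_level pp n -> evl v x = act (sec x) v.
Proof. by rewrite /evl => ->. Qed.

Lemma evl_out n v (x : K n) : x \notin Iw_level pp n -> evl v x = 0.
Proof. by rewrite /evl => /negPf ->. Qed.

Definition riemann n v mu : Pol := vpair (mu n) (evl (n := n) v).

Lemma riemannE n v mu :
  riemann n v mu = \sum_(x in Iw_level pp n) mu n x *: act (sec x) v.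
Proof.
rewrite /riemann /vpair [RHS]big_mkcond; apply: eq_bigr => x _.
by case: ifPn => [/evl_in-> //|/evl_out->]; rewrite scaler0.
Qed.

(** As [mu n] is the pushforward of [mu n.+1], the coarse sum is the fine one with sample point
    [sec (trans x)] in place of [sec x]. *)
Lemma riemann_step n v mu : neqmod n.+1 (riemann n.+1 v mu) (riemann n v mu).
Proof.
rewrite {2}/riemann iw_compP vpair_push; apply: neqmod_vpair => x.
rewrite [X in neqmod _ _ X](_ : _ = evl v (trans x)) //.
have [xI|xI] := boolP (x \in Iw_level pp n.+1); last first.
  by rewrite !evl_out ?trans_Iw //; apply: neqmod_refl.
rewrite !evl_in ?trans_Iw //.
apply: act_congr => i j.
apply: GL_red_eqmod.
- exact: sec_unit.
- exact: sec_unit.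
- by rewrite trans_sec GL_red_sec.
Qed.

Lemma riemann_le n k v mu : neqmod n.+1 (riemann (n + k) v mu) (riemann n v mu).
Proof.
elim: k => [|k IHk]; first by rewrite addn0; apply: neqmod_refl.
rewrite addnS; apply: neqmod_trans IHk.
by apply: neqmod_le (riemann_step _ _ _); rewrite ltnS leq_addr.
Qed.

(** This removes the choices from the definition: the sample points become [sec], and an eventual
    congruence becomes one congruence at each level. *)
Lemma Iw_integralP v mu w :
  Iw_integral psi v mu w <-> forall n, neqmod n.+1 w (riemann n v mu).
Proof.
split=> [vw n|vw N].
  (* The definition controls only levels beyond [n0]; [riemann_le] brings the congruence back down
     to level [n]. *)
  have [n0 /(_ (n + n0)%N (fun x => sec x)) vn0] := vw n.+1.
  apply: neqmod_trans (riemann_le n n0 v mu).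
  apply/neqmod_coefP => i; rewrite /eqmod -coefB riemannE.
  apply: vn0 => [|x xI]; first exact: leq_addl.
  by split; [apply: Iw_sec | apply: GL_red_sec].
exists N => n s Nn sP i.
suff: neqmod N w (\sum_(x in Iw_level pp n) mu n x *: act (s x) v).
  by move/neqmod_coefP/(_ i); rewrite /eqmod -coefB.
apply: neqmod_trans (neqmod_le (leqW Nn) (vw n)) _; rewrite riemannE.
apply: (@neqmod_le _ n.+1); first exact: leqW.
apply: neqmod_sum => x xI; apply: neqmodZ; apply: act_congr => i' j.
have [[us _] sx] := sP x xI; apply: GL_red_eqmod.
- exact: sec_unit.
- exact: us.
- by rewrite GL_red_sec sx.
Qed.

Lemma Iw_integral_linear c v v' mu w w' :
  Iw_integral psi v mu w -> Iw_integral psi v' mu w' ->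
  Iw_integral psi (c *: v + v') mu (c *: w + w').
Proof.
move=> /Iw_integralP vw /Iw_integralP vw'; apply/Iw_integralP => n.
have -> : riemann n (c *: v + v') mu = c *: riemann n v mu + riemann n v' mu.
  rewrite !riemannE scaler_sumr -big_split; apply: eq_bigr => x _ /=.
  by rewrite act_is_linear scalerDr !scalerA (mulrC c).
by apply: neqmodD => //; apply: neqmodZ.
Qed.

Lemma Iw_integral0 mu : Iw_integral psi (0 : Pol) mu 0.
Proof.
apply/Iw_integralP => n; rewrite riemannE big1; first exact: neqmod_refl.
by move=> y _; rewrite act0 scaler0.
Qed.

Lemma Iw_integral_lincomb (I : finType) (c : I -> O) (v w : I -> Pol) mu :
  (forall i, Iw_integral psi (v i) mu (w i)) ->
  Iw_integral psi (\sum_i c i *: v i) mu (\sum_i c i *: w i).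
Proof.
move=> vw; apply: (big_ind2 (fun v w : Pol => Iw_integral psi v mu w)) => [|v1 w1 v2 w2 h1 h2|i _].
- exact: Iw_integral0.
- by rewrite -[v1]scale1r -[w1]scale1r; apply: Iw_integral_linear.
- by rewrite -[c i *: v i]addr0 -[c i *: w i]addr0; apply: Iw_integral_linear (vw i) (Iw_integral0 mu).
Qed.

Lemma Iw_integral_linear_mu c v mu mu' w w' :
  Iw_integral psi v mu w -> Iw_integral psi v mu' w' ->
  Iw_integral psi v (c *: mu + mu') (c *: w + w').
Proof.
move=> /Iw_integralP vw /Iw_integralP vw'; apply/Iw_integralP => n.
have -> : riemann n v (c *: mu + mu') = c *: riemann n v mu + riemann n v mu'.
  rewrite !riemannE scaler_sumr -big_split; apply: eq_bigr => x _.
  by rewrite iwasawa_linE scalerDl -(scalerA c).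
by apply: neqmodD => //; apply: neqmodZ.
Qed.

Lemma Iw_integral_sum_mu (I : finType) v (mu : I -> Lambda) (w : I -> Pol) :
  (forall i, Iw_integral psi v (mu i) (w i)) ->
  Iw_integral psi v (\sum_i mu i) (\sum_i w i).
Proof.
move=> vw; elim/big_ind2: _ => //.
  apply/Iw_integralP => n; rewrite riemannE big1; first exact: neqmod_refl.
  by move=> x _; rewrite ffunE scale0r.
move=> mu1 w1 mu2 w2 H1 H2; rewrite -[mu1]scale1r -[w1]scale1r.
exact: Iw_integral_linear_mu.
Qed.

Hypothesis psiM : forall a b c d : 'F_p, a != 0 -> b != 0 -> c != 0 -> d != 0 ->
  psi (a * c) (b * d) = psi a b * psi c d.

(** On Iw the determinant is the product of the diagonal entries modulo p, so the twist depends on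
    the diagonal residues alone, and these are multiplicative on Iw. *)
Lemma psi_Iw (g : 'M[Zp]_2) : Iw g ->
  psi (modp_red (\det g) / modp_red (g 1 1)) (modp_red (g 1 1)) =
  psi (modp_red (g 0 0)) (modp_red (g 1 1)).
Proof.
move=> Ig; have [_ d0] := Iw_diag Ig; case: Ig => _ g0.
by rewrite det2 rmorphB !rmorphM /= g0 mulr0 subr0 mulfK.
Qed.

Lemma actM (g h : 'M[Zp]_2) v : Iw g -> Iw h -> act (g *m h) v = act h (act g v).
Proof.
move=> Ig Ih; have Igh := Iw_mul Ig Ih; have [g0 g1] := Iw_diag Ig.
have [h0 h1] := Iw_diag Ih.
rewrite /Iw_slash map_mxM slashM slashZ scalerA !psi_Iw //; congr (_ *: _).
have [_ g10] := Ig; have [_ h10] := Ih.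
rewrite mulrC -psiM // !mul_mx2E !rmorphD !rmorphM /= g10 h10.
by rewrite mulr0 addr0 mul0r add0r.
Qed.

Lemma evlM n v (y z : K n) : y \in Iw_level pp n -> z \in Iw_level pp n ->
  neqmod n.+1 (evl v (y * z)%g) (act (sec z) (act (sec y) v)).
Proof.
move=> yI zI; rewrite evl_in ?Iw_levelM // -actM; try exact: Iw_sec.
apply: act_congr => i j; apply: GL_red_eqmod.
- exact: sec_unit.
- by rewrite unitmx_mul !sec_unit.
- by rewrite GL_redM ?sec_unit // !GL_red_sec.
Qed.

(** Fubini for convolution: in the double sum, [evlM] replaces the value at [y * z] by the iterated
    action, with an error divisible by p^(n+1). *)
Lemma Iw_integral_mul v w w' mu nu :
  supported (@Iw_level p pp) mu -> supported (@Iw_level p pp) nu ->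
  Iw_integral psi v mu w -> Iw_integral psi w nu w' -> Iw_integral psi v (mu * nu) w'.
Proof.
move=> smu snu /Iw_integralP vw /Iw_integralP ww; apply/Iw_integralP => n.
apply: neqmod_trans (ww n) _.
have -> : riemann n v (mu * nu) =
    vpair (nu n) (fun z => vpair (mu n) (fun y => evl v (y * z)%g)).
  exact: vpair_mulC.
apply: neqmod_sum => z _; have [zI|zI] := boolP (z \in Iw_level pp n); last first.
  by rewrite snu // !scale0r; apply: neqmod_refl.
rewrite (evl_in _ zI).
apply: neqmodZ; apply: neqmod_trans (act_neqmod (sec z) (vw n)) _.
rewrite act_vpair; apply: neqmod_sum => y _.
have [yI|yI] := boolP (y \in Iw_level pp n); last first.
  by rewrite smu // !scale0r; apply: neqmod_refl.
by apply: neqmodZ; apply: neqmod_sym; rewrite (evl_in _ yI); apply: evlM.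
Qed.

Lemma Iw_integral_dirac v (g : 'M[Zp]_2) : Iw g -> Iw_integral psi v (K_dirac O g) (act g v).
Proof.
move=> Ig; apply/Iw_integralP => n; rewrite /riemann vpair_pt.
rewrite evl_in ?(mem_Iw_level Ig.1 erefl) ?Ig.2 ?eqxx //.
apply: act_congr => i j; apply: GL_red_eqmod; last by rewrite GL_red_sec.
  by case: Ig.
exact: sec_unit.
Qed.

Hypothesis O_sep : forall x : O, (forall n, divides (p%:R ^+ n) x) -> x = 0.
Hypothesis O_complete : forall u : nat -> O,
  (forall n, divides (p%:R ^+ n) (u n.+1 - u n)) ->
  exists x, forall n, divides (p%:R ^+ n) (x - u n).

Lemma Iw_integral_uniq v mu w w' :
  Iw_integral psi v mu w -> Iw_integral psi v mu w' -> w = w'.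
Proof.
move=> /Iw_integralP vw /Iw_integralP vw'; apply: val_inj; apply/polyP => i.
apply/eqP; rewrite -subr_eq0; apply/eqP; apply: O_sep => n.
have ww : neqmod n.+1 w w' by apply: neqmod_trans (vw n) (neqmod_sym (vw' n)).
by have /neqmod_coefP/(_ i) := neqmod_le (leqnSn n) ww.
Qed.

Lemma Iw_integral_exists v mu : exists w, Iw_integral psi v mu w.
Proof.
have /choice[c cP] i : exists x : O, forall n,
    divides (p%:R ^+ n) (x - (riemann n v mu : {poly O})`_i).
  apply: O_complete => n; have /neqmod_coefP := riemann_step n v mu.
  by move=> /(_ i) /(divides_exp (leqnSn n)).
exists (npolyp m.+1 (\poly_(i < m.+1) c i)); apply/Iw_integralP => n.
apply/neqmod_coefP => i; rewrite coef_npolyp coef_poly.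
have [im|im] := ltnP i m.+1; last first.
  rewrite nth_default; first exact: eqmod_refl.
  by apply: leq_trans im; apply: size_npoly.
(* At level [n], [cP] gives only the modulus p^n; it is therefore used at level [n.+1], and the sum
   there is compared with the one at level [n]. *)
apply: eqmod_trans (cP i n.+1) _; have /neqmod_coefP := riemann_step n v mu.
exact.
Qed.
End Integral.

(** * Decomposition of measures and completeness of O *)

Section Measures.
Context {A : comNzRingType} {T : tower}.
Local Notation Lambda := (iwasawa A T).
Implicit Types (mu nu : Lambda) (S : forall n, {set T n}).

Lemma iwasawa_1E n : (1 : Lambda) n = galg_pt A 1%g.
Proof. by []. Qed.

Lemma iwasawa_sumE (I : finType) (P : pred I) (f : I -> Lambda) n z :
  (\sum_(i | P i) f i) n z = \sum_(i | P i) f i n z.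
Proof.
elim/big_ind2: _ => // [|mu1 a1 mu2 a2 <- <-]; first by rewrite /= ffunE.
by rewrite /= ffunE.
Qed.

Lemma supportedD S mu nu : supported S mu -> supported S nu -> supported S (mu + nu).
Proof. by move=> smu snu n x xS; rewrite /= ffunE smu ?snu ?addr0. Qed.

Lemma supportedZ S c mu : supported S mu -> supported S (c *: mu).
Proof. by move=> smu n x xS; rewrite /= ffunE smu ?mulr0. Qed.

Lemma supported_sum S (I : finType) (f : I -> Lambda) :
  (forall i, supported S (f i)) -> supported S (\sum_i f i).
Proof. by move=> sf n x xS; rewrite iwasawa_sumE big1 // => i _; apply: sf. Qed.

Lemma supportedM S mu nu : (forall n x y, x \in S n -> y \in S n -> (x * y)%g \in S n) ->
  supported S mu -> supported S nu -> supported S (mu * nu).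
Proof.
move=> SM smu snu n x xS; rewrite /= ffunE big1 // => y _; rewrite big1 // => z /eqP yz.
have [yS|yS] := boolP (y \in S n); last by rewrite smu ?mul0r.
have [zS|zS] := boolP (z \in S n); last by rewrite snu ?mulr0.
by rewrite -yz SM in xS.
Qed.

Lemma supported_sub S S' mu : (forall n x, x \in S n -> x \in S' n) ->
  supported S mu -> supported S' mu.
Proof. by move=> SS smu n x xS; apply: smu; apply: contra xS; apply: SS. Qed.

(** The augmentation. Pushforward preserves total mass, so level 0 may be used here and any other
    level through [aug_level]. *)
Definition aug mu : A := galg_pair (mu 0%N) (fun=> 1).

Lemma aug_level n mu : galg_pair (mu n) (fun=> 1) = aug mu.
Proof. by elim: n => // n <-; rewrite [in RHS]iw_compP galg_pair_push. Qed.

Lemma augM mu nu : aug (mu * nu) = aug mu * aug nu.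
Proof.
rewrite /aug galg_pair_mul {1}/galg_pair [in RHS]/galg_pair big_distrl.
by apply: eq_bigr => x _; rewrite mulr1.
Qed.

Lemma augD mu nu : aug (mu + nu) = aug mu + aug nu.
Proof. exact: galg_pairD. Qed.

Lemma augN mu : aug (- mu) = - aug mu.
Proof. exact: galg_pairN. Qed.

Lemma aug_sum (I : finType) (f : I -> Lambda) : aug (\sum_i f i) = \sum_i aug (f i).
Proof.
elim/big_ind2: _ => // [|mu1 a1 mu2 a2 <- <-]; last exact: augD.
exact: galg_pair0.
Qed.

Lemma aug_const c : aug (iwasawa_const T c) = c.
Proof. by rewrite /aug [LHS]galg_pairZ galg_pair_pt mulr1. Qed.

(** [H] is a module over the converse ring, so scaling a vector multiplies its coordinate by a
    constant on the right; the product is identified here with the scaled coordinate. *)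
Lemma mul_constE c mu : mu * iwasawa_const T c = c *: mu.
Proof.
apply: iwasawa_inj => n; apply: galg_ext => phi; rewrite [LHS]galg_pair_mul [RHS]galg_pairZ.
rewrite /galg_pair big_distrr; apply: eq_bigr => x _ /=.
by rewrite -/(galg_pair _ _) galg_pairZ galg_pair_pt mulg1 mulrCA.
Qed.

Lemma supported_const S (c : A) : (forall n, 1%g \in S n) -> supported S (iwasawa_const T c).
Proof.
move=> S1 n x xS; rewrite /= !ffunE; case: eqP => [x1|_]; last exact: mulr0.
by rewrite x1 S1 in xS.
Qed.
End Measures.

Lemma GL_redV {p : nat} {pp : prime p} (R : finComUnitRingType)
  (f : {rmorphism padic_int pp -> R}) (g : 'M[padic_int pp]_2) :
  g \in unitmx -> GL_red f (invmx g) = (GL_red f g)^-1%g.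
Proof.
move=> ug; apply: (mulIg (GL_red f g)).
by rewrite -GL_redM ?unitmx_inv // mulVmx // GL_red1 mulVg.
Qed.

Lemma galg_pt_mul (A : comNzRingType) (gT : finGroupType) (g : gT) (a : {ffun gT -> A}) z :
  galg_mul (galg_pt A g) a z = a (g^-1 * z)%g.
Proof.
have pairE (b : {ffun gT -> A}) t : b t = galg_pair b (fun w => (w == t)%:R).
  rewrite /galg_pair (bigD1 t) //= eqxx mulr1 big1 ?addr0 // => y /negPf->.
  exact: mulr0.
rewrite [LHS]pairE [LHS]galg_pair_mul galg_pair_pt [RHS]pairE.
by congr galg_pair; apply/funext => w; rewrite (can2_eq (mulKg _) (mulKVg _)).
Qed.

Lemma galg_mul_pt (A : comNzRingType) (gT : finGroupType) (g h : gT) :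
  galg_mul (galg_pt A g) (galg_pt A h) = galg_pt A (g * h)%g.
Proof. by apply: galg_ext => phi; rewrite galg_pair_mul !galg_pair_pt. Qed.

Section Decomposition.
Context {A : comNzRingType} {p : nat} {pp : prime p}.
Local Notation K := (K_tower pp).
Local Notation Lambda := (iwasawa A K).
Local Notation Zp := (padic_int pp).
Implicit Types (mu nu : Lambda) (g h : 'M[Zp]_2).

Lemma K_diracE g n : K_dirac A g n = galg_pt A (GL_red (@level_red p pp n) g).
Proof. by []. Qed.

Lemma iwasawa_mulE mu nu n : (mu * nu) n = galg_mul (mu n) (nu n).
Proof. by []. Qed.

Lemma K_diracM g h : g \in unitmx -> h \in unitmx ->
  K_dirac A g * K_dirac A h = K_dirac A (g *m h).
Proof.
move=> ug uh; apply: iwasawa_inj => n.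
by rewrite iwasawa_mulE !K_diracE galg_mul_pt GL_redM.
Qed.

Lemma K_dirac1 : K_dirac A (1%:M : 'M[Zp]_2) = 1.
Proof.
apply: iwasawa_inj => n; rewrite K_diracE.
by rewrite iwasawa_1E (GL_red1 (@level_red p pp n)).
Qed.

Lemma K_dirac_mulE g mu n z :
  (K_dirac A g * mu) n z = mu n ((GL_red (@level_red p pp n) g)^-1 * z)%g.
Proof. by rewrite iwasawa_mulE K_diracE galg_pt_mul. Qed.

(** [proj0] factors through [trans], so cutting a measure down to a fibre of [proj0] commutes with
    pushforward. *)
Lemma restr_subproof mu (x : K 0) n :
  [ffun z : K n => if proj0 z == x then mu n z else 0] =
  galg_push (@trans K n) [ffun z : K n.+1 => if proj0 z == x then mu n.+1 z else 0].
Proof.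
apply/ffunP => z; rewrite !ffunE iw_compP ffunE.
case: ifPn => zx.
  by apply: eq_bigr => y /eqP yz; rewrite ffunE proj0S yz zx.
by rewrite big1 // => y /eqP yz; rewrite ffunE proj0S yz (negPf zx).
Qed.

Definition restr mu x : Lambda := Iwasawa (restr_subproof mu x).

Lemma sum_restr mu : \sum_x restr mu x = mu.
Proof.
apply: iwasawa_inj => n; apply/ffunP => z; rewrite iwasawa_sumE (bigD1 (proj0 z)) //=.
rewrite ffunE eqxx big1 ?addr0 // => x xz.
by rewrite ffunE eq_sym (negPf xz).
Qed.

(** The piece of [mu] above [x], translated back by [r x]; it lives on I_1 as soon as [r x] reduces
    into the coset of [x] modulo I_1. It serves with [r] equal to [sec] for measures on K and to
    [trep] for measures on Iw. *)
Definition part (r : K 0 -> 'M[Zp]_2) mu x : Lambda :=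
  K_dirac A (invmx (r x)) * restr mu x.

Variable r : K 0 -> 'M[Zp]_2.

Lemma restr_part mu x : r x \in unitmx -> K_dirac A (r x) * part r mu x = restr mu x.
Proof.
by move=> ur; rewrite mulrA K_diracM ?unitmx_inv // mulmxV // K_dirac1 mul1r.
Qed.

Lemma supported_part mu x : r x \in unitmx ->
  ((GL_red (@level_red p pp 0) (r x))^-1 * x)%g \in I1_level pp 0 ->
  supported (@I1_level p pp) (part r mu x).
Proof.
move=> ur rI n z zI; rewrite K_dirac_mulE ffunE; case: eqP => // zx.
move: zx; rewrite (GL_redV _ ur) invgK proj0M proj0_GL_red => zx.
have /negP[] := zI; rewrite -proj0_I1.
by move: rI; rewrite -[X in (_^-1 * X)%g]zx mulKg.
Qed.

Lemma part0 mu x : (forall n z, proj0 z = x -> mu n z = 0) -> part r mu x = 0.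
Proof.
move=> mu0; rewrite /part [restr _ _](_ : _ = 0) ?mulr0 //.
by apply: iwasawa_inj => n; apply/ffunP => z; rewrite !ffunE; case: eqP => // /mu0.
Qed.
End Decomposition.

Section ModuleCoordinates.
Context {p : nat} {pp : prime p} {E : fieldExtType (padic_num pp)}.
Local Notation O := (integers E).
Local Notation K := (K_tower pp).
Local Notation Lambda := (iwasawa O K).
Local Notation I1 := (@I1_level p pp).
Context {H : lmodType Lambda^c}.
Variable e : H.
Implicit Types mu nu : Lambda.
Hypothesis basis_e : forall x : H, exists! mu : Lambda,
  supported I1 mu /\ x = (mu : Lambda^c) *: e.

Lemma I1_1 n : 1%g \in I1 n.
Proof.
rewrite (@mem_I1_level _ _ _ _ 1%:M) ?unitmx1 //; last exact: GL_red1.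
by rewrite !mxE !rmorph1 rmorph0 !eqxx.
Qed.

Lemma ract_mul mu nu (x : H) :
  (mu : Lambda^c) *: ((nu : Lambda^c) *: x) = (nu * mu : Lambda^c) *: x.
Proof. exact: scalerA. Qed.

Lemma basis_inj mu nu : supported I1 mu -> supported I1 nu ->
  (mu : Lambda^c) *: e = (nu : Lambda^c) *: e -> mu = nu.
Proof.
move=> smu snu mn; have [k [_ kP]] := basis_e ((mu : Lambda^c) *: e).
by rewrite -(kP mu) // -(kP nu).
Qed.

(* Every element of [K] is [sec x] times an element of [I1], so a measure divisible
   by [p ^ n] at level [n] moves [e] by a coordinate whose mass is divisible by
   [p ^ n]. *)
Lemma aug_filtration n mu : supported I1 mu ->
  @module_filtration p pp E H n ((mu : Lambda^c) *: e) -> divides (p%:R ^+ n) (aug mu).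
Proof.
move=> smu [k [nu [y [nuF muE]]]].
have /choice[ka kaP] i : exists ka : Lambda, [/\ supported I1 ka,
    (nu i : Lambda^c) *: y i = (ka : Lambda^c) *: e & divides (p%:R ^+ n) (aug ka)].
  have /choice[c cP] (x : K 0) : exists c : Lambda, supported I1 c /\
      (K_dirac O (sec x) : Lambda^c) *: y i = (c : Lambda^c) *: e.
    by have [c [cP _]] := basis_e ((K_dirac O (sec x) : Lambda^c) *: y i); exists c.
  have ps (x : K 0) : supported I1 (part sec (nu i) x).
    apply: supported_part; first exact: sec_unit.
    by rewrite GL_red_sec (mulVg x) I1_1.
  exists (\sum_x c x * part sec (nu i) x); split.
  - apply: supported_sum => x; apply: supportedM => //; last exact: (cP x).1.
    exact: I1_levelM.
  - rewrite -[in LHS](sum_restr (nu i)) !scaler_suml; apply: eq_bigr => x _.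
    by rewrite -(restr_part (r := sec)) ?sec_unit // -!ract_mul (cP x).2.
  - rewrite aug_sum; apply: divides_sum => x _; rewrite !augM; do 2 apply: divides_mull.
    rewrite -(aug_level n); apply: divides_sum => z _; rewrite mulr1 ffunE.
    by case: ifP => _; [apply: nuF | apply: divides0].
have -> : mu = \sum_i ka i.
  apply: basis_inj => //; first by apply: supported_sum => i; case: (kaP i).
  by rewrite muE scaler_suml; apply: eq_bigr => i _; case: (kaP i).
by rewrite aug_sum; apply: divides_sum => i _; case: (kaP i).
Qed.

Hypothesis H_complete : complete_filtration (@module_filtration p pp E H).

Lemma const_filtration n (a : O) : divides (p%:R ^+ n) a ->
  @module_filtration p pp E H n ((iwasawa_const K a : Lambda^c) *: e).
Proof.
case=> b ->; exists 1%N, (fun=> iwasawa_const K (p%:R ^+ n * b)), (fun=> e).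
split=> [_ x|]; last by rewrite big_ord1.
by rewrite /= !ffunE -mulrA; exists (b * (x == 1%g)%:R).
Qed.

(** The multiple of [e] by [a] lies in every step of the filtration of [H], hence vanishes, and
    coordinates are unique. *)
Lemma integers_separated (a : O) : (forall n, divides (p%:R ^+ n) a) -> a = 0.
Proof.
move=> a0; have [_ [sep _]] := H_complete.
have := sep _ (fun n => const_filtration (a0 n)) => ae0.
rewrite -(aug_const (T := K) a) (@basis_inj (iwasawa_const K a) 0) ?[aug _]galg_pair0 //.
- by apply: supported_const => n; apply: I1_1.
- by move=> n x _; rewrite /= ffunE.
- by rewrite scale0r.
Qed.

Lemma integers_complete (u : nat -> O) :
  (forall n, divides (p%:R ^+ n) (u n.+1 - u n)) ->
  exists x, forall n, divides (p%:R ^+ n) (x - u n).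
Proof.
move=> uC; have [_ [_ comp]] := H_complete.
have [|x xP] := comp (fun n => (iwasawa_const K (u n) : Lambda^c) *: e) => [n|].
  have -> : (iwasawa_const K (u n.+1) : Lambda^c) *: e -
      (iwasawa_const K (u n) : Lambda^c) *: e =
      (iwasawa_const K (u n.+1 - u n) : Lambda^c) *: e.
    have -> : iwasawa_const K (u n.+1 - u n) =
        iwasawa_const K (u n.+1) - iwasawa_const K (u n) by apply: scalerBl.
    by rewrite [RHS]scalerBl.
  exact: const_filtration.
have [mu [[smu xE] _]] := basis_e x; exists (aug mu) => n.
rewrite -[u n](aug_const (T := K)) -augN -augD; apply: aug_filtration.
  apply: supportedD => //; rewrite -scaleN1r; apply: supportedZ.
  by apply: supported_const => k; apply: I1_1.
by rewrite [X in _ X](scalerBl (mu : Lambda^c)) -xE; apply: xP.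
Qed.
End ModuleCoordinates.

(** * Ranks over domains *)

Section Rank.
Context {R : comNzRingType}.
Hypothesis R_domain : forall x y : R, x * y = 0 -> x <> 0 -> y = 0.

(** Gaussian elimination without division: rows are multiplied by the pivot to clear the last
    column, and the absence of zero divisors keeps the relation nontrivial. *)
Lemma dependent_rows n (a : 'I_n.+1 -> nat -> R) : exists c : 'I_n.+1 -> R,
  (forall j, (j < n)%N -> \sum_i c i * a i j = 0) /\ exists i, c i <> 0.
Proof.
elim: n a => [|n IHn] a.
  by exists (fun=> 1); split=> //; exists ord0; apply/eqP; apply: oner_neq0.
(* [x] is a pivot of column [n]; when that column vanishes, any row together with [x = 1] satisfies
   the same identity. *)
have [i0 [x [x0 xP]]] : exists i0 x, x <> 0 /\ forall i, x * a i n = a i n * a i0 n.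
  have [[i0 ai0]|/forallNP a0] := pselect (exists i0, a i0 n <> 0).
    by exists i0, (a i0 n); split=> // i; rewrite mulrC.
  exists ord0, 1; split=> [|i]; first by apply/eqP; apply: oner_neq0.
  by have /contrapT-> := a0 i; rewrite mulr0 mul0r.
pose b k j := x * a (lift i0 k) j - a (lift i0 k) n * a i0 j.
have [c [cP [k0 ck0]]] := IHn b.
(* The coefficient of row [i0] collects the correction terms of the rows [b k]; column [n] vanishes
   by the choice of [x]. *)
exists (fun i => if unlift i0 i is Some k then x * c k
                 else - \sum_k c k * a (lift i0 k) n).
split=> [j jn|]; last first.
  by exists (lift i0 k0); rewrite liftK => /R_domain/(_ x0).
rewrite (bigD1_ord i0) //= unlift_none mulNr big_distrl addrC -sumrB /=.
have E k : x * c k * a (lift i0 k) j - c k * a (lift i0 k) n * a i0 j = c k * b k j.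
  by rewrite /b mulrBr !mulrA (mulrC x).
under eq_bigr do rewrite liftK E.
move: jn; rewrite ltnS leq_eqVlt => /predU1P[->|/cP //].
by apply: big1 => k _; rewrite /b xP subrr mulr0.
Qed.

Context {M : lmodType R}.
Implicit Types U : set M.

Lemma independent_lift n (b : 'I_n.+1 -> M) :
  independent b -> independent (fun i => b (lift ord0 i)).
Proof.
move=> ib c cb i; have := ib (fun j => oapp c 0 (unlift ord0 j)).
rewrite (bigD1_ord ord0) //= unlift_none scale0r add0r.
under eq_bigr do rewrite liftK /=.
by move=> /(_ cb (lift ord0 i)); rewrite liftK.
Qed.

(** [has_rank] excludes independent families of exactly [d.+1] vectors; a longer family is shortened
    to that size by dropping vectors. *)
Lemma has_rank_le U d d' : has_rank U d -> has_rank U d' -> (d' <= d)%N.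
Proof.
move=> [_ Ud] [[b [bU ib]] _]; rewrite leqNgt; apply/negP => /subnKC dd'.
move: dd' b bU ib => <-; elim: (d' - d.+1)%N => [|k IHk]; rewrite ?addn0 // addnS.
move=> b bU ib; apply: (IHk (fun i => b (lift ord0 i))) => //.
exact: independent_lift.
Qed.

Lemma rankP U d : has_rank U d -> rank U = d.
Proof.
move=> Ud; apply: xget_unique => // d' Ud'; apply/eqP; rewrite eqn_leq.
by rewrite (has_rank_le Ud Ud') (has_rank_le Ud' Ud).
Qed.
End Rank.

(** * Equivariant maps and torus-fixed polynomials *)

Section Teichmuller.
Context {p : nat} {pp : prime p}.
Local Notation Zp := (padic_int pp).
Local Notation K := (K_tower pp).
Implicit Types (a b : 'F_p).

Lemma mx2E (R : Type) (a b c d : R) :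
  (mx2 a b c d 0 0 = a) * (mx2 a b c d 0 1 = b) *
  (mx2 a b c d 1 0 = c) * (mx2 a b c d 1 1 = d).
Proof. by rewrite !mxE. Qed.

Definition tdiag a b : 'M[Zp]_2 := mx2 (teichmuller pp a) 0 0 (teichmuller pp b).

Lemma tdiag_mulE a b (g : 'M[Zp]_2) : (tdiag a b *m g) 0 =1 (fun j => teichmuller pp a * g 0 j)
  /\ (tdiag a b *m g) 1 =1 (fun j => teichmuller pp b * g 1 j).
Proof. by split=> j; rewrite mul_mx2E !mx2E mul0r ?addr0 ?add0r. Qed.

Lemma tdiag1 : tdiag 1 1 = 1%:M.
Proof.
by rewrite /tdiag teichmuller1; apply/matrixP => -[[|[|//]] ?] [[|[|//]] ?]; rewrite !mxE.
Qed.

Lemma tdiag_unit a b : a != 0 -> b != 0 -> tdiag a b \in unitmx.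
Proof.
by move=> a0 b0; rewrite unitmxE det2 !mx2E mulr0 subr0 unitrM !teichmuller_unit.
Qed.

Lemma Iw_tdiag a b : a != 0 -> b != 0 -> Iw (tdiag a b).
Proof. by move=> a0 b0; split; [exact: tdiag_unit | rewrite mx2E rmorph0]. Qed.

Lemma tdiag_exp a b n : tdiag a b ^+ n = mx2 (teichmuller pp a ^+ n) 0 0 (teichmuller pp b ^+ n).
Proof.
elim: n => [|n IHn].
  by apply/matrixP => -[[|[|//]] ?] [[|[|//]] ?]; rewrite !mxE.
rewrite exprS IHn; apply/matrixP => i j; rewrite [LHS]mul_mx2E !exprS.
by case: i j => [[|[|//]] ?] [[|[|//]] ?]; rewrite !mxE /= ?(mulr0, mul0r, addr0, add0r).
Qed.

Lemma Delta2_tdiag a b : a != 0 -> b != 0 -> Delta2 (tdiag a b).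
Proof.
move=> a0 b0; split; first exact: tdiag_unit.
  by apply/is_diag_mxP => -[[|[|//]] ?] [[|[|//]] ?]; rewrite !mxE.
exists p.-1; first by rewrite -subn1 subn_gt0 prime_gt1.
by rewrite tdiag_exp !(teichmullerP _).1 // -[RHS]tdiag1 /tdiag teichmuller1.
Qed.

(* The Teichmuller representative of the torus part of [x] when [x] is in the
   Iwahori subgroup. *)
Definition trep (x : K 0) : 'M[Zp]_2 :=
  if x \in Iw_level pp 0 then tdiag (modp_red (sec x 0 0)) (modp_red (sec x 1 1))
  else tdiag 1 1.

Lemma trep_tdiag x : exists a b, [/\ a != 0, b != 0 & trep x = tdiag a b].
Proof.
rewrite /trep; case: ifP => [/Iw_sec/Iw_diag[a0 b0]|_].
  by exists (modp_red (sec x 0 0)), (modp_red (sec x 1 1)).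
by exists 1, 1; rewrite oner_neq0.
Qed.

Lemma trep_unit x : trep x \in unitmx.
Proof. by have [a [b [a0 b0 ->]]] := trep_tdiag x; apply: tdiag_unit. Qed.

(** The entries of the quotient [g] are read off modulo p from [trep x *m g = sec x], where the
    nonzero diagonal residues cancel. *)
Lemma trep_I1 x : x \in Iw_level pp 0 ->
  ((GL_red (@level_red p pp 0) (trep x))^-1 * x)%g \in I1_level pp 0.
Proof.
move=> xI; have us := sec_unit x; have ut := trep_unit x.
pose g := invmx (trep x) *m sec x.
have ug : g \in unitmx by rewrite unitmx_mul unitmx_inv ut.
rewrite (@mem_I1_level _ _ _ _ g) //; last first.
  by rewrite GL_redM ?unitmx_inv // (GL_redV _ ut) GL_red_sec.
have [a0 b0] := Iw_diag (Iw_sec xI); have [_ c0] := Iw_sec xI.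
have gE : trep x *m g = sec x by rewrite mulKVmx.
move: gE; rewrite /trep xI => gE.
have [g0 g1] := tdiag_mulE (modp_red (sec x 0 0)) (modp_red (sec x 1 1)) g.
have red0 j : modp_red (sec x 0 0) * modp_red (g 0 j) = modp_red (sec x 0 j).
  by have /(congr1 (@modp_red p pp)) := g0 j; rewrite gE rmorphM /= (teichmullerP a0).2.
have red1 j : modp_red (sec x 1 1) * modp_red (g 1 j) = modp_red (sec x 1 j).
  by have /(congr1 (@modp_red p pp)) := g1 j; rewrite gE rmorphM /= (teichmullerP b0).2.
apply/and3P; split; apply/eqP.
- by apply: (mulfI b0); rewrite red1 mulr0.
- by apply: (mulfI a0); rewrite red0 mulr1.
- by apply: (mulfI b0); rewrite red1 mulr1.
Qed.
End Teichmuller.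

Section Homs.
Context {p : nat} {pp : prime p} {E : fieldExtType (padic_num pp)}.
Local Notation Zp := (padic_int pp).
Local Notation O := (integers E).
Local Notation K := (K_tower pp).
Local Notation Lambda := (iwasawa O K).
Local Notation I1 := (@I1_level p pp).
Local Notation IW := (@Iw_level p pp).
Context {H : lmodType Lambda^c} {e : H}.
Context {psi : 'F_p -> 'F_p -> O} {m : nat}.
Local Notation Pol := {poly_m.+1 O}.
Local Notation act := (@Iw_slash p pp E psi m).
Implicit Types (mu nu : Lambda) (v w : Pol).

Hypothesis basis_e : forall x : H, exists! mu : Lambda,
  supported I1 mu /\ x = (mu : Lambda^c) *: e.
Hypothesis e_fixed : forall a b : 'F_p, a != 0 -> b != 0 ->
  (K_dirac O (tdiag (pp := pp) a b) : Lambda^c) *: e = e.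
Hypothesis H_complete : complete_filtration (@module_filtration p pp E H).
Hypothesis psiM : forall a b c d : 'F_p, a != 0 -> b != 0 -> c != 0 -> d != 0 ->
  psi (a * c) (b * d) = psi a b * psi c d.

Let O_sep := integers_separated basis_e H_complete.
Let O_complete := integers_complete basis_e H_complete.

Definition torus_fixed v :=
  forall a b : 'F_p, a != 0 -> b != 0 -> act (tdiag a b) v = v.

Lemma Iw_integral_trep v x : torus_fixed v -> Iw_integral psi v (K_dirac O (trep x)) v.
Proof.
move=> fv; have [a [b [a0 b0 ->]]] := trep_tdiag x.
by rewrite -{2}(fv a b) //; apply: Iw_integral_dirac => //; apply: Iw_tdiag.
Qed.

Lemma supported_dirac (g : 'M[Zp]_2) : Iw g -> supported IW (K_dirac O g).
Proof.
move=> [ug g0] n x xI; rewrite K_diracE ffunE; case: eqP => // xg.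
by have /negP[] := xI; rewrite (mem_Iw_level ug (esym xg)) g0.
Qed.

(** Outside Iw the value of [trep] is a default, but there [mu] vanishes and the piece with it. *)
Lemma supported_part_Iw mu x : supported IW mu -> supported I1 (part trep mu x).
Proof.
move=> smu; have [xI|xI] := boolP (x \in IW 0).
  by apply: supported_part; [apply: trep_unit | apply: trep_I1].
rewrite part0; first by move=> n z _; rewrite /= ffunE.
by move=> n z zx; apply: smu; rewrite -proj0_Iw zx.
Qed.

(* [Iw] is [I1] times the torus, which fixes both [e] and [v]. *)
Lemma Iw_integral_fold v mu w : torus_fixed v -> supported IW mu ->
  Iw_integral psi v mu w -> exists nu : Lambda,
    [/\ supported I1 nu, (mu : Lambda^c) *: e = (nu : Lambda^c) *: e
      & Iw_integral psi v nu w].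
Proof.
move=> fv smu vw.
have sp x := supported_part_Iw x smu.
have /choice[wx wxP] (x : K 0) : exists wx, Iw_integral psi v (part trep mu x) wx.
  exact: Iw_integral_exists.
have wE : w = \sum_x wx x.
  apply: (Iw_integral_uniq O_sep vw); rewrite -(sum_restr mu).
  apply: Iw_integral_sum_mu => x; rewrite -(restr_part (r := trep)) ?trep_unit //.
  apply: (Iw_integral_mul psiM (v := v) (w := v)) => //.
  - have [a [b [a0 b0 ->]]] := trep_tdiag x.
    by apply: supported_dirac; apply: Iw_tdiag.
  - by apply: supported_sub (sp x); apply: I1_sub_Iw.
  - exact: Iw_integral_trep.
exists (\sum_x part trep mu x); split.
- exact: supported_sum.
- rewrite -{1}(sum_restr mu) !scaler_suml; apply: eq_bigr => x _.
  rewrite -(restr_part (r := trep)) ?trep_unit // -ract_mul.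
  by have [a [b [a0 b0 ->]]] := trep_tdiag x; rewrite e_fixed.
- by rewrite wE; apply: Iw_integral_sum_mu.
Qed.

Local Notation hom := (@Iw_hom p pp E H psi m).

(** Equivariance is applied to the Dirac measure of a torus element: it fixes [e], and integrating
    against it is the action of that element. *)
Lemma hom_torus_fixed phi : hom phi -> torus_fixed (phi e).
Proof.
move=> [_ phiP] a b a0 b0.
have I := Iw_tdiag (pp := pp) a0 b0.
have phi_e := phiP e _ (supported_dirac I); rewrite e_fixed // in phi_e.
have act_e : Iw_integral psi (phi e) (K_dirac O (tdiag a b)) (act (tdiag a b) (phi e)).
  exact: Iw_integral_dirac.
exact (Iw_integral_uniq O_sep act_e phi_e).
Qed.

(** Integration is linear in the polynomial, so a relation between the values at [e] spreads to
    every vector. This reduces the upper bound on the rank to linear algebra on coefficients. *)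
Lemma hom_eq0 n (phi : 'I_n -> coef_mod H -> Pol) (c : 'I_n -> O) :
  (forall i, hom (phi i)) -> \sum_i c i *: phi i e = 0 -> \sum_i c i *: phi i = 0.
Proof.
move=> hphi ce; apply/funext => x; rewrite fct_sumE.
have [mu [[smu ->] _]] := basis_e x.
have smuI : supported IW mu by apply: supported_sub smu; apply: I1_sub_Iw.
have := @Iw_integral_lincomb p pp E psi m _ c (fun i => phi i e)
  (fun i => phi i ((mu : Lambda^c) *: e)) mu (fun i => (hphi i).2 e mu smuI).
rewrite ce => int_sum.
exact (Iw_integral_uniq O_sep int_sum (Iw_integral0 (psi := psi) mu)).
Qed.

Lemma hom_exists v : torus_fixed v -> exists2 phi, hom phi & phi e = v.
Proof.
move=> fv.
have /choice[co coP] (x : H) : exists mu : Lambda, supported I1 mu /\ x = (mu : Lambda^c) *: e.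
  by have [mu [muP _]] := basis_e x; exists mu.
have coE (x : H) mu : supported I1 mu -> x = (mu : Lambda^c) *: e -> co x = mu.
  move=> smu xE; have [sx xE'] := coP x.
  by apply: (basis_inj basis_e) => //; rewrite -xE.
have /choice[phi phiP] (x : coef_mod H) : exists w, Iw_integral psi v (co x) w.
  exact: Iw_integral_exists.
exists phi; last first.
  (* The coordinate of [e] is 1, the Dirac measure at the identity, written as [tdiag 1 1]. *)
  have I := Iw_tdiag (pp := pp) (oner_neq0 _) (oner_neq0 _).
  apply: (Iw_integral_uniq O_sep (phiP e)); rewrite (@coE e 1).
  - rewrite -K_dirac1 -tdiag1 -{2}(fv 1 1) ?oner_neq0 //.
    exact: Iw_integral_dirac.
  - have -> : (1 : Lambda) = iwasawa_const K 1 by rewrite /iwasawa_const scale1r.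
    by apply: supported_const => n; apply: I1_1.
  - by rewrite [RHS]scale1r.
split=> [c x y|x mu smu].
  apply: (Iw_integral_uniq O_sep (phiP _)).
  rewrite (@coE (c *: x + y) (c *: co x + co y)).
  - exact: Iw_integral_linear_mu.
  - by apply: supportedD; [apply: supportedZ|]; apply: (coP _).1.
  rewrite [RHS]scalerDl -(coP y).2; congr (_ + _).
  by rewrite -mul_constE -ract_mul -(coP x).2.
have [w wP] := Iw_integral_exists O_complete (psi := psi) (phi x) mu.
suff -> : phi ((mu : Lambda^c) *: x) = w by [].
have sx : supported IW (co x) by apply: supported_sub (coP x).1; apply: I1_sub_Iw.
(* [co x * mu] carries [e] to the translate of [x] by [mu], but it is only known to be supported on
   Iw; folding yields the coordinate on I_1 with the same integral. *)
have [nu [snu nuE vw]] : exists nu : Lambda,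
    [/\ supported I1 nu, (co x * mu : Lambda^c) *: e = (nu : Lambda^c) *: e
      & Iw_integral psi v nu w].
  apply: Iw_integral_fold => //; first by apply: supportedM => //; exact: Iw_levelM.
  exact: (Iw_integral_mul psiM (w := phi x)).
apply: (Iw_integral_uniq O_sep (phiP _)).
by rewrite (@coE _ nu) // -nuE -ract_mul -(coP x).2.
Qed.
End Homs.

(** * Torus weights of the monomials *)

Section TorusCharacters.
Context {p : nat} {pp : prime p} {E : fieldExtType (padic_num pp)}.
Local Notation O := (integers E).
Local Notation teich := (teichmuller pp).
Implicit Types (a b c d : 'F_p).

Lemma integers_domain (x y : O) : x * y = 0 -> x <> 0 -> y = 0.
Proof.
move=> /(congr1 (@int_val _ _ E))/= /eqP; rewrite mulf_eq0 => /orP[/eqP x0|/eqP y0] nx0.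
  by case: nx0; apply: val_inj.
exact: val_inj.
Qed.

Lemma padic_integer_inj : injective (padic_integer E).
Proof.
move=> x y /(congr1 (@int_val _ _ E)) /=.
by move=> /(fmorph_inj (in_alg E))/eqP; rewrite tofrac_eq => /eqP.
Qed.

Lemma omega_charM (i j : int) a b c d : a != 0 -> b != 0 -> c != 0 -> d != 0 ->
  omega_char E i j (a * c) (b * d) = omega_char E i j a b * omega_char E i j c d.
Proof.
move=> a0 b0 c0 d0; rewrite /omega_char -rmorphM !teichmullerM //.
by rewrite !exprzMl ?teichmuller_unit // mulrACA.
Qed.

(** The [p.-1] nonzero elements are distinct (p-1)-th roots of unity in a field, which forces one of
    exact order [p.-1]. *)
Lemma Fp_primitive_root : exists a : 'F_p, p.-1.-primitive_root a.
Proof.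
have p1 : (0 < p.-1)%N by rewrite -subn1 subn_gt0 prime_gt1.
have pE : p.-1.+1 = p by rewrite prednK // prime_gt0.
have /hasP[a _ ?] : has p.-1.-primitive_root [seq a <- enum 'F_p | a != 0].
  apply: has_prim_root => //.
  - apply/allP => a; rewrite mem_filter => /andP[a0 _]; rewrite unity_rootE.
    apply/eqP; apply: (mulIf a0); rewrite mul1r -exprSr pE.
    by rewrite -[X in a ^+ X](card_Fp pp) expf_card.
  - by rewrite filter_uniq // enum_uniq.
  - rewrite size_filter -ltnS pE -[X in (X <= _)%N](card_Fp pp) cardE.
    rewrite -(count_predC (pred1 0) (enum 'F_p)) count_uniq_mem ?enum_uniq //.
    by rewrite mem_enum add1n ltnS; apply: leqnn.
by exists a.
Qed.

Section Psi.
Variables (s m : nat).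

(* [psi k] for [k = m + 2] *)
Definition tchar a b : O :=
  omega_char E (- s%:Z) s%:Z a b * omega_char E 0 (- m%:Z) a b.

Lemma tcharM a b c d : a != 0 -> b != 0 -> c != 0 -> d != 0 ->
  tchar (a * c) (b * d) = tchar a b * tchar c d.
Proof. by move=> *; rewrite /tchar !omega_charM // mulrACA. Qed.

(** The eigenvalue of [tdiag a b] on z^i, left as the product of its three sources: the character of
    exponent [s], the twist by [m], and the slash. The powers with exponent [m] cancel. *)
Definition weight i a b := teich a ^ (- s%:Z) * teich b ^ s%:Z *
  (teich a ^ 0 * teich b ^ (- m%:Z)) * (teich a ^+ i * teich b ^+ (m - i)).

(** Multiplying by the unit teich(a)^s teich(b)^i clears the negative exponents. *)
Lemma weight_eq1 i a b : a != 0 -> b != 0 -> (i <= m)%N ->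
  weight i a b = 1 <-> teich a ^+ i * teich b ^+ s = teich a ^+ s * teich b ^+ i.
Proof.
move=> a0 b0 im; have ua := teichmuller_unit (pp := pp) a0.
have ub := teichmuller_unit (pp := pp) b0.
have A : teich a ^- s * teich a ^+ s = 1 by rewrite mulVr ?unitrX.
have B : teich b ^- m * (teich b ^+ (m - i) * teich b ^+ i) = 1.
  by rewrite -exprD subnK // mulVr ?unitrX.
pose W := weight i a b.
have WE : W * (teich a ^+ s * teich b ^+ i) = teich a ^+ i * teich b ^+ s.
  rewrite /W /weight expr0z mul1r -!exprnN -!exprnP -[RHS]mul1r -{}B -[RHS]mul1r -{}A.
  ring.
rewrite -/W; split=> [W1|WW]; first by rewrite -WE W1 mul1r.
have u : teich a ^+ s * teich b ^+ i \is a GRing.unit by rewrite unitrM !unitrX.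
by apply: (mulIr u); rewrite mul1r WE.
Qed.

Lemma coef_tdiag i a b (v : {poly_m.+1 O}) : a != 0 -> b != 0 -> (i <= m)%N ->
  (Iw_slash tchar (tdiag a b) v : {poly O})`_i =
  padic_integer E (weight i a b) * (v : {poly O})`_i.
Proof.
move=> a0 b0 im; have I := Iw_tdiag (pp := pp) a0 b0.
rewrite /Iw_slash psi_Iw // coefZ coef_slash_diag ?mxE ?rmorph0 // mulrA.
rewrite !(teichmullerP _).2 // /tchar /omega_char -!rmorphXn -!rmorphM.
by [].
Qed.

Lemma torus_fixedP (v : {poly_m.+1 O}) : torus_fixed (psi := tchar) v <->
  forall i, (i <= m)%N -> i != s %[mod p.-1] -> (v : {poly O})`_i = 0.
Proof.
split=> [fv i im ni|v0 a b a0 b0].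
  (* The torus elements (a, 1) with [a] of order p - 1 suffice: a nonzero coefficient forces a^i =
     a^s, hence i = s modulo p - 1. *)
  have [a pa] := Fp_primitive_root.
  have a0 : a != 0.
    apply/eqP => a0; have := prim_expr_order pa.
    rewrite a0 expr0n eqn0Ngt -subn1 subn_gt0 (prime_gt1 pp).
    by move/esym/eqP; rewrite oner_eq0.
  apply: contrapT => vi0; case/negP: ni; apply/eqP.
  have := congr1 (fun u : {poly_m.+1 O} => (u : {poly O})`_i) (fv a 1 a0 (oner_neq0 _)).
  rewrite coef_tdiag ?oner_neq0 // => /eqP; rewrite -subr_eq0 -[X in _ - X]mul1r -mulrBl.
  rewrite mulrC => /eqP/integers_domain/(_ vi0)/eqP.
  rewrite subr_eq0 -(rmorph1 (padic_integer E)) => /eqP/padic_integer_inj.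
  move/(weight_eq1 a0 (oner_neq0 _) im); rewrite teichmuller1 !expr1n !mulr1.
  move/(congr1 (@modp_red p pp)); rewrite !rmorphXn /= (teichmullerP a0).2 => /eqP.
  by rewrite (eq_prim_root_expr pa) => /eqP.
apply: val_inj; apply/polyP => i.
have [im|mi] := leqP i m; last by rewrite !nth_default //; apply: leq_trans mi; apply: size_npoly.
rewrite coef_tdiag //; have [is_|ni] := eqVneq (i %% p.-1)%N (s %% p.-1)%N; last first.
  by rewrite v0 // mulr0.
suff -> : weight i a b = 1 by rewrite rmorph1 mul1r.
apply/weight_eq1 => //.
have tE c : c != 0 -> teich c ^+ i = teich c ^+ s.
  move=> c0; have [c1 _] := teichmullerP (pp := pp) c0.
  by rewrite -(expr_mod i c1) is_ expr_mod.
by rewrite !tE.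
Qed.
End Psi.
End TorusCharacters.

Lemma coef_npoly_lincomb (R : comNzRingType) n (I : finType) (c : I -> R)
  (u : I -> {poly_n R}) k :
  (\sum_i c i *: u i : {poly_n R})`_k = \sum_i c i * (u i : {poly R})`_k.
Proof.
apply: (big_ind2 (fun (x : {poly_n R}) y => (x : {poly R})`_k = y)) => [|x a y b <- <-|i _].
- exact: coef0.
- exact: coefD.
- exact: coefZ.
Qed.

(** * Counting exponents and the rank *)

Section RankOfHoms.
Context {p : nat} {pp : prime p} {E : fieldExtType (padic_num pp)}.
Local Notation O := (integers E).
Local Notation Lambda := (iwasawa O (K_tower pp)).

(** Counts the exponents s, s + (p-1), ... up to [m]. Without the test, truncated subtraction would
    count one exponent when m < s. *)
Definition rank_formula s m := if (s <= m)%N then ((m - s) %/ p.-1).+1 else 0%N.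

Lemma p_pred_gt0 : (0 < p.-1)%N.
Proof. by rewrite -subn1 subn_gt0 prime_gt1. Qed.

Lemma ltn_rank_formula s m t : (t < rank_formula s m)%N = (s + t * p.-1 <= m)%N.
Proof.
rewrite /rank_formula; case: (leqP s m) => [sm|ms].
  by rewrite ltnS leq_divRL ?p_pred_gt0 // leq_subRL.
by symmetry; apply: contraTF ms; rewrite -leqNgt; apply: leq_trans; apply: leq_addr.
Qed.

Lemma has_rank_Iw_hom (H : lmodType Lambda^c) (e : H) (s m : nat) :
  (forall x : H, exists! mu : Lambda,
     supported (@I1_level p pp) mu /\ x = (mu : Lambda^c) *: e) ->
  (forall a b : 'F_p, a != 0 -> b != 0 ->
     (K_dirac O (tdiag (pp := pp) a b) : Lambda^c) *: e = e) ->
  complete_filtration (@module_filtration p pp E H) -> (s < p.-1)%N ->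
  has_rank (@Iw_hom p pp E H (tchar s m) m) (rank_formula s m).
Proof.
move=> basis_e e_fixed H_complete sp; set d := rank_formula s m.
pose ex t := (s + t * p.-1)%N.
have ex_le (t : nat) : (t < d)%N -> (ex t <= m)%N by rewrite ltn_rank_formula.
have ex_inj t u : ex t = ex u -> t = u.
  by move=> /addnI/eqP; rewrite eqn_pmul2r ?p_pred_gt0 // => /eqP.
have ex_mod t : (ex t = s %[mod p.-1])%N by rewrite /ex addnC modnMDl.
have tM := @tcharM p pp E s m.
split.
  (* Lower bound: the maps attached to the monomials with exponents [ex t] are separated by the
     coefficients at these exponents. *)
  have /choice[phi phiP] (t : 'I_d) : exists phi : coef_mod H -> {poly_m.+1 O},
      @Iw_hom p pp E H (tchar s m) m phi /\ phi e = npolyp m.+1 'X^(ex t).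
    have fX : torus_fixed (psi := @tchar p pp E s m) (npolyp m.+1 'X^(ex t)).
      apply/torus_fixedP => i im ni; rewrite coef_npolyp coefXn.
      case: ifP => // _; case: eqP => // iE.
      by move: ni; rewrite iE ex_mod eqxx.
    by have [phi] := hom_exists basis_e e_fixed H_complete tM fX; exists phi.
  exists phi; split=> [t|c cphi t]; first exact: (phiP t).1.
  have ce : \sum_i c i *: phi i e = 0.
    by have := congr1 (fun f : coef_mod H -> {poly_m.+1 O} => f e) cphi; rewrite fct_sumE.
  have := congr1 (fun u : {poly_m.+1 O} => (u : {poly O})`_(ex t)) ce.
  rewrite /= coef_npoly_lincomb coef0 (bigD1 t) //= big1 ?addr0.
    by rewrite (phiP t).2 coef_npolyp coefXn ltnS ex_le // eqxx mulr1.
  move=> u ut; rewrite (phiP u).2 coef_npolyp coefXn; case: ifP => _; last exact: mulr0.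
  case: eqP => [/ex_inj tu|_]; last exact: mulr0.
  by case/eqP: ut; apply: val_inj.
move=> phi hphi indep.
have fx i := hom_torus_fixed basis_e e_fixed H_complete (hphi i).
(* Upper bound: the [d.+1] values at [e] have only [d] coefficients that can be nonzero, so they
   satisfy a relation, which [hom_eq0] extends to the maps. *)
have [c [cP [i0 ci0]]] := dependent_rows (@integers_domain p pp E)
  (fun (i : 'I_d.+1) t => (phi i e : {poly O})`_(ex t)).
apply: ci0; apply: indep.
apply: (hom_eq0 basis_e H_complete hphi).
apply: val_inj; apply/polyP => i; rewrite [LHS]coef_npoly_lincomb coef0.
have [im|mi] := leqP i m; last first.
  rewrite big1 // => j _; rewrite nth_default ?mulr0 //.
  by apply: leq_trans mi; apply: size_npoly.
have [is_|ni] := eqVneq (i %% p.-1)%N (s %% p.-1)%N; last first.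
  by rewrite big1 // => j _; have /torus_fixedP/(_ i im ni)-> := fx j; rewrite mulr0.
(* Since s < p - 1, the residue of [s] is [s] itself, so no admissible exponent lies below [s]. *)
have iE : i = ex (i %/ p.-1)%N.
  by rewrite /ex {1}(divn_eq i p.-1) is_ modn_small // addnC.
rewrite iE; apply: cP.
by rewrite ltn_rank_formula -/(ex _) -iE.
Qed.

Lemma rank_formulaE s m : (s < p.-1)%N ->
  (rank_formula s m)%:Z = ((m%:Z - s%:Z) %/ (p%:Z - 1))%Z + 1.
Proof.
move=> sp; have pE : p%:Z - 1 = p.-1%:Z.
  by rewrite -[in LHS](prednK (prime_gt0 pp)) -addn1 PoszD addrK.
rewrite pE /rank_formula; case: (leqP s m) => [sm|ms].
  by rewrite subzn // divz_nat -addn1 PoszD.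
(* Here m - s lies strictly between -(p - 1) and 0, so the floor is -1 and the formula gives 0. *)
have -> : m%:Z - s%:Z = (-1) * p.-1%:Z + (m + p.-1 - s)%N%:Z.
  rewrite -subzn; last by apply: leq_trans (leq_addl _ _); apply: ltnW.
  by rewrite PoszD; ring.
rewrite divzMDl; last by rewrite eqz_nat -lt0n p_pred_gt0.
rewrite divz_nat divn_small //.
by rewrite ltn_subLR ?ltn_add2r // (leq_trans _ (leq_addl _ _)) // ltnW.
Qed.
End RankOfHoms.

(** * The formula for all weights and along a class of weights modulo p - 1 *)

Unset Implicit Arguments.

Theorem proposition3p1
    (p : nat) (pp : prime p) (p_ge11 : (11 <= p)%N)
    (* E, a uniformizer of its ring of integers, and the residue field F *)
    (E : fieldExtType (padic_num pp)) (varpi : integers E)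
    (hvarpi : uniformizer varpi)
    (F : fieldType) (red : {rmorphism integers E -> F})
    (hred : residue_map red varpi)
    (* rhobar *)
    (Qpbar : closedFieldType) (iota : {rmorphism padic_num pp -> Qpbar})
    (hQpbar : algebraic_closure iota)
    (rhobar : (Qpbar -> Qpbar) -> 'M[F]_2)
    (hrhobar : tres_ramifiee_rep iota rhobar)
    (* the primitive projective-augmented module *)
    (H : lmodType (iwasawa (integers E) (K_tower pp))^c)
    (act : coef_mod H -> 'M[padic_num pp]_2 -> coef_mod H)
    (primH : primitive_module red varpi act)
    (normH : normalized_module act)
    (s : nat) (hs : (s <= p - 2)%N) :
  let psi (k : nat) (a b : 'F_p) : integers E :=
    omega_char E (- s%:Z) s%:Z a b * omega_char E 0 (2 - k%:Z) a b in
  let d (k : nat) : nat := d_Iw H k (psi k) in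
  let k_eps := (2 + (2 * s) %% (p - 1))%N in
  let delta := ((2 * s) %/ (p - 1))%N in
  [/\ forall k : nat, (2 <= k)%N ->
        has_rank (@Iw_hom p pp E H (psi k) (k - 2)) (d k) /\
        (d k)%:Z = ((k%:Z - 2 - s%:Z) %/ (p%:Z - 1))%Z + 1,
      forall kb : nat,
        (d (k_eps + (p - 1) * kb)%N)%:Z = kb%:Z + 1 - delta%:Z,
      forall k : nat, (2 <= k)%N -> d (k + p - 1)%N = (d k).+1 &
      exists kb : nat, odd (d (k_eps + (p - 1) * kb)%N)].
Proof.
move=> psi d k_eps delta.
have p1 : (0 < p.-1)%N by apply: p_pred_gt0.
have sp : (s < p.-1)%N.
  by apply: leq_ltn_trans hs _; rewrite -subn1 ltn_sub2l ?prime_gt1.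
have pZ : p%:Z - 1 = p.-1%:Z.
  by rewrite -[in LHS](prednK (prime_gt0 pp)) -addn1 PoszD addrK.
have [_ [e [basis_e e_Delta2 _]]] := normH.
have e_fixed (a b : 'F_p) : a != 0 -> b != 0 ->
    (K_dirac (integers E) (tdiag (pp := pp) a b) : (iwasawa (integers E) (K_tower pp))^c) *: e = e.
  move=> a0 b0; have t2 := Delta2_tdiag (pp := pp) a0 b0.
  rewrite -(prim_extends primH); last by case: t2.
  exact: e_Delta2.
(* Completeness of [H] is part of its description as a completed tensor product. *)
have H_complete : complete_filtration (@module_filtration p pp E H).
  by have [H0 [G0 [act0 [tau [_ _ _ [Hc _ _ _] _]]]]] := prim_tensor primH.
have dP k : (2 <= k)%N ->
    has_rank (@Iw_hom p pp E H (psi k) (k - 2)) (d k) /\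
    (d k)%:Z = ((k%:Z - 2 - s%:Z) %/ (p%:Z - 1))%Z + 1.
  move=> k2; have psiE : psi k = tchar s (k - 2).
    apply/funext => a; apply/funext => b; rewrite /psi /tchar.
    by rewrite -subzn // opprB.
  have rk := has_rank_Iw_hom (k - 2) basis_e e_fixed H_complete sp.
  have -> : d k = rank_formula (p := p) s (k - 2) by rewrite /d /d_Iw psiE; apply: rankP.
  by rewrite psiE; split=> //; rewrite rank_formulaE // -subzn.
have divE (q : int) : ((q * p.-1%:Z + s%:Z) %/ p.-1%:Z)%Z = q.
  rewrite divzMDl ?eqz_nat -?lt0n // divz_nat divn_small //.
  exact: addr0.
have d_eps (kb : nat) : (d (k_eps + (p - 1) * kb)%N)%:Z = kb%:Z + 1 - delta%:Z.
  have k2 : (2 <= k_eps + (p - 1) * kb)%N by rewrite /k_eps -addnA leq_addr.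
  (* Writing 2s = delta (p - 1) + r, the numerator r + (p - 1) kb - s becomes (kb - delta)(p - 1) +
     s, where 0 <= s < p - 1. *)
  have [_ ->] := dP _ k2; rewrite pZ [RHS]addrAC; congr (_ + _).
  rewrite -[RHS]divE; congr (_ %/ _)%Z.
  have := congr1 Posz (divn_eq (2 * s) p.-1); rewrite PoszD !PoszM => e2s.
  have rE : ((2 * s) %% p.-1)%N%:Z = 2%:Z * s%:Z - ((2 * s) %/ p.-1)%N%:Z * p.-1%:Z.
    by rewrite e2s; ring.
  rewrite /k_eps /delta !subn1 !PoszD PoszM rE; ring.
split=> //.
- move=> k k2; apply/eqP; rewrite -eqz_nat; apply/eqP.
  have k2' : (2 <= k + p - 1)%N by rewrite -addnBA ?prime_gt0 // (leq_trans k2) ?leq_addr.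
  rewrite (dP _ k2').2 -[(d k).+1]addn1 PoszD (dP _ k2).2; congr (_ + _).
  have -> : (k + p - 1)%N%:Z = k%:Z + p.-1%:Z.
    by rewrite -PoszD -subn1 addnBA ?prime_gt0.
  rewrite pZ.
  have -> : k%:Z + p.-1%:Z - 2 - s%:Z = 1 * p.-1%:Z + (k%:Z - 2 - s%:Z) by ring.
  by rewrite divzMDl ?eqz_nat -?lt0n // addrC.
(* At kb = delta the formula gives rank 1. *)
- exists delta; have : d (k_eps + (p - 1) * delta)%N = 1%N; last by move->.
  by apply/eqP; rewrite -eqz_nat d_eps addrAC subrr add0r.
Qed.
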